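(* Let $n\geq 4$ and let the two-dimensional torus $G=(k^\times)^2$ act on the $n$-th Weyl algebra $A_n=k[Q_1,\ldots,Q_n,P_1,\ldots,P_n]$ by the $2\times n$ matrix whose $j$-th column is $(1,0)^T$ for $j$ odd and $(0,1)^T$ for $j$ even; that is, for $g=(g_1,g_2)\in G$, $g\cdot Q_j=g_1Q_j$ and $g\cdot P_j=g_1^{-1}P_j$ for $j$ odd, while $g\cdot Q_j=g_2Q_j$ and $g\cdot P_j=g_2^{-1}P_j$ for $j$ even. Then $A_n^G$ is a Noetherian FCR-algebra of Gelfand–Kirillov dimension $2n-2$. In particular, there are Noetherian FCR-algebras of every even Gelfand–Kirillov dimension $\geq 6$.
   Context: $k$ is an algebraically closed field of characteristic $0$. $A_n$ is the ring of differential operators on $k^n$, with $Q_i$ the coordinate functions and $P_i=\partial/\partial Q_i$; $A_n^G$ is the ring of $G$-invariants. A $k$-algebra $R$ is an FCR-algebra if (i) $R$ has enough finite dimensional modules, i.e. the intersection of the annihilators of all finite dimensional $R$-modules is zero, and (ii) every finite dimensional $R$-module is completely reducible. *)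

(* Defs.v *)
From HB Require Import structures.
From mathcomp Require Import all_boot all_order all_algebra.
From mathcomp Require Import boolp classical_sets functions.
From mathcomp Require Import reals ereal topology normedtype sequences exp.
(* Importing the notations of mpoly clashes with mathcomp-analysis. *)
From mathcomp Require Import -(notations) mpoly.

Set Implicit Arguments.
Unset Strict Implicit.
Unset Printing Implicit Defensive.

Import Order.TTheory GRing.Theory Num.Theory.
Local Open Scope ring_scope.

Section Noetherian.

(* [submod_closed] and [{pred M}] cover all submodules: every propositional
   predicate is boolean by [boolp.asbool]. *)
Definition noetherian_module (R : nzRingType) (M : lmodType R) : Prop :=
  forall I : nat -> {pred M},
    (forall i, submod_closed (I i)) ->
    (forall i, {subset I i <= I i.+1}) ->
    exists N : nat, forall i : nat, (N <= i)%N -> I i =i I N.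

(* Two-sided: left ideals of [R^c] are the right ideals of [R]. *)
Definition noetherian (R : nzRingType) : Prop :=
  noetherian_module R^o /\ noetherian_module (R^c)^o.

End Noetherian.

Section FCR.

Definition completely_reducible (R : nzRingType) (M : lmodType R) : Prop :=
  forall S : {pred M}, submod_closed S ->
    exists T : {pred M},
      [/\ submod_closed T,
          forall x : M, exists u v : M, [/\ u \in S, v \in T & x = u + v]
        & forall x : M, x \in S -> x \in T -> x = 0].

Variable k : fieldType.

(* [k] acts on the [A]-module [M] through the scalars [c%:A] of [A]. *)
Definition finite_dimensional (A : algType k) (M : lmodType A) : Prop :=
  exists s : seq M, forall x : M,
    exists c : 'I_(size s) -> k, x = \sum_i (c i)%:A *: s`_i.

Definition enough_finite_dimensional_modules (A : algType k) : Prop :=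
  forall a : A,
    (forall M : lmodType A, finite_dimensional M -> forall x : M, a *: x = 0) ->
    a = 0.

Definition FCR (A : algType k) : Prop :=
  enough_finite_dimensional_modules A /\
  (forall M : lmodType A, finite_dimensional M -> completely_reducible M).

End FCR.

Section GelfandKirillov.

Variable k : fieldType.

(* The dimension of the [k]-span of [s], as the maximal cardinality of a
   linearly independent subfamily of [s]. *)
Definition dim_span (V : lmodType k) (s : seq V) : nat :=
  \max_(I : {set 'I_(size s)} |
        `[< forall c : 'I_(size s) -> k,
              \sum_(i in I) c i *: s`_i = 0 -> forall i, i \in I -> c i = 0 >])
     #|I|.

(* All products of at most [m] factors from [s]; if [s] spans [V], they span
   k + V + V^2 + ... + V^m. *)
Fixpoint words (A : algType k) (s : seq A) (m : nat) : seq A :=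
  if m is m'.+1 then 1 :: [seq a * w | a <- s, w <- words s m'] else [:: 1].

(* sup over the finite dimensional subspaces V of A of
   limsup_m log (dim (k + V + ... + V^m)) / log m *)
Definition GKdim (RR : realType) (A : algType k) : \bar RR :=
  ereal_sup [set limn_esup (fun m : nat =>
                   (ln (dim_span (words s m))%:R / ln m%:R)%:E)
            | s in [set: seq A]]%classic.

End GelfandKirillov.

Section Weyl.

Variables (k : fieldType) (n : nat).

Local Notation pol := (mpoly n k).

Definition mulX (i : 'I_n) : pol -> pol := fun p => mpolyX k (mnm1 i) * p.
Definition derX (i : 'I_n) : pol -> pol := fun p => mderiv i p.

Inductive weyl_op : (pol -> pol) -> Prop :=
| weyl_op_id : weyl_op id
| weyl_op_Q i : weyl_op (mulX i)
| weyl_op_P i : weyl_op (derX i)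
| weyl_op_lin c f g : weyl_op f -> weyl_op g -> weyl_op (c *: f + g)
| weyl_op_comp f g : weyl_op f -> weyl_op g -> weyl_op (f \o g).

Definition weyl_pred : {pred (pol -> pol)} := fun f => `[< weyl_op f >].

Lemma weyl_predP f : reflect (weyl_op f) (f \in weyl_pred).
Proof. exact: asboolP. Qed.

Lemma weyl_op0 : weyl_op 0.
Proof.
have -> : (0 : pol -> pol) = (-1) *: (id : pol -> pol) + id.
  by rewrite scaleN1r addNr.
by apply: weyl_op_lin; apply: weyl_op_id.
Qed.

Lemma weyl_pred_submod : submod_closed weyl_pred.
Proof.
split; first by apply/weyl_predP; exact: weyl_op0.
move=> c f g /weyl_predP hf /weyl_predP hg.
by apply/weyl_predP; apply: weyl_op_lin.
Qed.

HB.instance Definition _ :=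
  GRing.isSubmodClosed.Build k (pol -> pol) weyl_pred weyl_pred_submod.

(* In characteristic 0 this is the ring of all differential operators on k^n. *)
Record weyl : Type := Weyl { weyl_fun :> pol -> pol; _ : weyl_fun \in weyl_pred }.

HB.instance Definition _ := [isSub for weyl_fun].
HB.instance Definition _ := [Choice of weyl by <:].
HB.instance Definition _ := [SubChoice_isSubLmodule of weyl by <:].

Lemma weyl_eqP (a b : weyl) : a =1 b -> a = b.
Proof. by move=> ab; apply/val_inj/funext. Qed.

Lemma weyl_opP (a : weyl) : weyl_op a.
Proof. by apply/weyl_predP; case: a. Qed.

Lemma weyl_linear (a : weyl) : linear a.
Proof.
elim: {a}(weyl_fun a) / (weyl_opP a) => // [i|i|c f g _ hf _ hg|f g _ hf _ hg].
- by move=> c p q; rewrite /mulX mulrDr scalerAr.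
- by move=> c p q; rewrite /derX linearP.
- move=> d p q; rewrite !fctE hf hg !scalerDr !scalerA (mulrC c d).
  by rewrite addrACA.
- by move=> d p q /=; rewrite hg hf.
Qed.

Definition weyl1 : weyl := Weyl (introT (weyl_predP _) weyl_op_id).
Definition weylM (a b : weyl) : weyl :=
  Weyl (introT (weyl_predP _) (weyl_op_comp (weyl_opP a) (weyl_opP b))).

Fact weyl_mulA : associative weylM.
Proof. by move=> a b c; apply: weyl_eqP. Qed.
Fact weyl_mul1l : left_id weyl1 weylM.
Proof. by move=> a; apply: weyl_eqP. Qed.
Fact weyl_mul1r : right_id weyl1 weylM.
Proof. by move=> a; apply: weyl_eqP. Qed.
Fact weyl_mulDl : left_distributive weylM +%R.
Proof. by move=> a b c; apply: weyl_eqP. Qed.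
Fact weyl_mulDr : right_distributive weylM +%R.
Proof.
move=> a b c; apply: weyl_eqP => p /=.
by have := weyl_linear a 1 (b p) (c p); rewrite !scale1r.
Qed.
Fact weyl_1neq0 : weyl1 != 0.
Proof.
apply/eqP => /(congr1 (fun a : weyl => a (1 : pol))) /= /eqP.
by apply/negP; exact: oner_neq0.
Qed.

HB.instance Definition _ := GRing.Zmodule_isNzRing.Build weyl
  weyl_mulA weyl_mul1l weyl_mul1r weyl_mulDl weyl_mulDr weyl_1neq0.

Fact weyl_scaleAl (c : k) (a b : weyl) : c *: (a * b) = (c *: a) * b.
Proof. by apply: weyl_eqP. Qed.
Fact weyl_scaleAr (c : k) (a b : weyl) : c *: (a * b) = a * (c *: b).
Proof.
apply: weyl_eqP => p /=; have := weyl_linear a c (b p) 0.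
have -> : a 0 = 0.
  by have := weyl_linear a (-1) 0 0; rewrite scaler0 addr0 scaleN1r addNr.
by rewrite !addr0.
Qed.

HB.instance Definition _ := GRing.Lmodule_isLalgebra.Build k weyl weyl_scaleAl.
HB.instance Definition _ := GRing.Lalgebra_isAlgebra.Build k weyl weyl_scaleAr.

Definition weylQ (i : 'I_n) : weyl := Weyl (introT (weyl_predP _) (weyl_op_Q i)).
Definition weylP (i : 'I_n) : weyl := Weyl (introT (weyl_predP _) (weyl_op_P i)).


End Weyl.

Section Rescaling.

Variables (k : fieldType) (n : nat).

Local Notation pol := (mpoly n k).
Implicit Types (w : 'I_n -> k) (p q : pol).

(* The algebra endomorphism of k[X_1, ..., X_n] with X_j |-> w_j X_j. *)
Definition rescale w : pol -> pol :=
  comp_mpoly [tuple w j *: mpolyX k (mnm1 j) | j < n].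

Lemma rescale_is_linear w : linear (rescale w).
Proof. by move=> c p q; rewrite /rescale linearP. Qed.

HB.instance Definition _ w :=
  GRing.isLinear.Build k pol pol *:%R (rescale w) (rescale_is_linear w).

Lemma rescaleM w p q : rescale w (p * q) = rescale w p * rescale w q.
Proof. by rewrite /rescale rmorphM. Qed.

Lemma rescale_mpolyX w (m : multinom n) :
  rescale w (mpolyX k m) = (\prod_j w j ^+ m j) *: mpolyX k m.
Proof.
rewrite /rescale comp_mpolyX [in RHS]mpolyXE_id -scaler_prod.
by apply: eq_bigr => j _; rewrite tnth_map tnth_ord_tuple exprZn.
Qed.

Lemma rescaleX w j :
  rescale w (mpolyX k (mnm1 j)) = w j *: mpolyX k (mnm1 j).
Proof.
rewrite rescale_mpolyX (bigD1 j) //= mnm1E eqxx expr1 big1 ?mulr1 // => i ij.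
by rewrite mnm1E eq_sym (negPf ij) expr0.
Qed.

Lemma eq_linear_mpoly (f g : pol -> pol) : linear f -> linear g ->
  (forall m, f (mpolyX k m) = g (mpolyX k m)) -> f =1 g.
Proof.
move=> lf lg fg; elim/mpolyind => [|c m p _ _ ih].
  have f0 (h : pol -> pol) : linear h -> h 0 = 0.
    by move=> lh; have := lh (-1) 0 0; rewrite scaler0 addr0 scaleN1r addNr.
  by rewrite !f0.
by rewrite lf lg fg ih.
Qed.

Lemma rescale_comp w v p :
  rescale w (rescale v p) = rescale (fun j => w j * v j) p.
Proof.
apply: (eq_linear_mpoly (f := rescale w \o rescale v)) => [c r q|c r q|m].
- by rewrite /= !linearP.
- by rewrite linearP.
rewrite /= rescale_mpolyX linearZ /= !rescale_mpolyX scalerA -big_split /=.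
by congr (_ *: _); apply: eq_bigr => j _; rewrite -exprMn mulrC.
Qed.

Lemma rescale1 w p : (forall j, w j = 1) -> rescale w p = p.
Proof.
move=> w1; apply: (eq_linear_mpoly (g := id)) => [c r q|//|m].
  by rewrite linearP.
by rewrite rescale_mpolyX big1 ?scale1r // => j _; rewrite w1 expr1n.
Qed.

Lemma rescale_mderiv w i p : w i != 0 ->
  rescale w (mderiv i p) = (w i)^-1 *: mderiv i (rescale w p).
Proof.
move=> wi0.
apply: (eq_linear_mpoly (f := rescale w \o @mderiv n k i)
          (g := fun q => (w i)^-1 *: mderiv i (rescale w q)))
       => [c r q|c r q|m].
- by rewrite /= !linearP.
- by rewrite !linearP.
rewrite /= rescale_mpolyX linearZ /= mderivX linearZ /= rescale_mpolyX.
rewrite !scalerA; have [->|mi0] := eqVneq (m i) 0%N.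
  by rewrite mulr0n mulr0 mul0r.
congr (_ *: _); rewrite (mulrC (m i)%:R); congr (_ * _).
rewrite (bigD1 i) //= [in RHS](bigD1 i) //= mulrA; congr (_ * _).
  rewrite mnmBE mnm1E eqxx subn1.
  by case: (m i) mi0 => // d _; rewrite exprS mulrA mulVf // mul1r.
by apply: eq_bigr => j ji; rewrite mnmBE mnm1E eq_sym (negPf ji) subn0.
Qed.

Lemma weyl_op_rescale w (f : pol -> pol) : (forall j, w j != 0) -> weyl_op f ->
  weyl_op (rescale w \o f \o rescale (fun j => (w j)^-1)).
Proof.
move=> w0; set v := fun j => (w j)^-1.
have wK p : rescale w (rescale v p) = p.
  by rewrite rescale_comp rescale1 // => j; rewrite mulfV.
have vK p : rescale v (rescale w p) = p.
  by rewrite rescale_comp rescale1 // => j; rewrite mulVf.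
have wZ c (g : pol -> pol) : weyl_op g -> weyl_op (c *: g).
  by move=> hg; rewrite -[c *: g]addr0; apply/weyl_op_lin/weyl_op0.
elim=> {f} [|i|i|c f g _ hf _ hg|f g _ hf _ hg].
- suff -> : rescale w \o id \o rescale v = id by exact: weyl_op_id.
  by apply/funext => p /=.
- suff -> : rescale w \o @mulX k n i \o rescale v = w i *: @mulX k n i.
    by apply/wZ/weyl_op_Q.
  apply/funext => p; rewrite !fctE /= /mulX rescaleM rescaleX wK.
  by rewrite scalerAl.
- suff -> : rescale w \o @derX k n i \o rescale v = (w i)^-1 *: @derX k n i.
    by apply/wZ/weyl_op_P.
  by apply/funext => p; rewrite !fctE /= /derX rescale_mderiv // wK.
- suff -> : rescale w \o (c *: f + g) \o rescale v =
      c *: (rescale w \o f \o rescale v) + (rescale w \o g \o rescale v).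
    exact: weyl_op_lin.
  by apply/funext => p; rewrite !fctE /= linearP.
- suff -> : rescale w \o (f \o g) \o rescale v =
      (rescale w \o f \o rescale v) \o (rescale w \o g \o rescale v).
    exact: weyl_op_comp.
  by apply/funext => p /=; rewrite vK.
Qed.

End Rescaling.

Section TorusAction.

Variables (k : fieldType) (m n : nat).

Local Notation pol := (mpoly n k).

Definition torus : Type := 'I_m -> {x : k | x != 0}.

Variable L : 'M[int]_(m, n).

Definition torus_weight (t : torus) (j : 'I_n) : k :=
  \prod_(i < m) val (t i) ^ L i j.

Lemma torus_weight_neq0 t j : torus_weight t j != 0.
Proof. by apply/prodf_neq0 => i _; apply/expfz_neq0/(valP (t i)). Qed.

(* [t] acts on k[X_1, ..., X_n] by X_j |-> w_j X_j, where w_j is its weight,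
   and on operators by conjugation; see [torus_actQ] and [torus_actP]. *)
Definition torus_act (t : torus) (a : weyl k n) : weyl k n :=
  Weyl (introT (weyl_predP _)
          (weyl_op_rescale (torus_weight_neq0 t) (weyl_opP a))).

Let rescaleVK t (p : pol) :
  rescale (torus_weight t) (rescale (fun j => (torus_weight t j)^-1) p) = p.
Proof.
by rewrite rescale_comp rescale1 // => j; rewrite mulfV ?torus_weight_neq0.
Qed.

Let rescaleKV t (p : pol) :
  rescale (fun j => (torus_weight t j)^-1) (rescale (torus_weight t) p) = p.
Proof.
by rewrite rescale_comp rescale1 // => j; rewrite mulVf ?torus_weight_neq0.
Qed.

Lemma torus_actQ t j :
  torus_act t (weylQ k j) = torus_weight t j *: weylQ k j.
Proof.
apply: weyl_eqP => p; rewrite /= /mulX rescaleM rescaleX rescaleVK.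
by rewrite -scalerAl.
Qed.

Lemma torus_actP t j :
  torus_act t (weylP k j) = (torus_weight t j)^-1 *: weylP k j.
Proof.
apply: weyl_eqP => p.
by rewrite /= /derX rescale_mderiv ?torus_weight_neq0 // rescaleVK.
Qed.

Lemma torus_act_is_linear t : linear (torus_act t).
Proof. by move=> c a b; apply: weyl_eqP => p /=; rewrite !fctE linearP. Qed.

Lemma torus_act_is_monoid_morphism t : monoid_morphism (torus_act t).
Proof.
split=> [|a b]; apply: weyl_eqP => p /=; first exact: rescaleVK.
by rewrite rescaleKV.
Qed.

HB.instance Definition _ t := GRing.isLinear.Build k (weyl k n) (weyl k n) *:%R
  (torus_act t) (torus_act_is_linear t).
HB.instance Definition _ t := GRing.isMonoidMorphism.Build (weyl k n) (weyl k n)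
  (torus_act t) (torus_act_is_monoid_morphism t).

Lemma torus_act1 (t : torus) a : (forall i, val (t i) = 1) -> torus_act t a = a.
Proof.
move=> t1; apply: weyl_eqP => p /=.
have w1 j : torus_weight t j = 1.
  by rewrite /torus_weight big1 // => i _; rewrite t1 exp1rz.
by rewrite !rescale1 // => j; rewrite w1 invr1.
Qed.

Lemma torus_act_comp (s t u : torus) a :
  (forall i, val (u i) = val (s i) * val (t i)) ->
  torus_act u a = torus_act s (torus_act t a).
Proof.
move=> ust; apply: weyl_eqP => p /=; rewrite !rescale_comp.
have wE j : torus_weight u j = torus_weight s j * torus_weight t j.
  rewrite /torus_weight -big_split; apply: eq_bigr => i _.
  by rewrite ust expfzMl.
congr (rescale _ (a (rescale _ p))); apply/funext => j; rewrite wE //.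
by rewrite invfM mulrC.
Qed.

Definition invariant_pred : {pred weyl k n} :=
  fun a => `[< forall t : torus, torus_act t a = a >].

Lemma invariant_subalg : subalg_closed invariant_pred.
Proof.
split=> [|c a b /asboolP ha /asboolP hb|a b /asboolP ha /asboolP hb];
  apply/asboolP => t.
- by rewrite rmorph1.
- by rewrite linearP /= ha hb.
- by rewrite rmorphM /= ha hb.
Qed.

HB.instance Definition _ :=
  GRing.isSubalgClosed.Build k (weyl k n) invariant_pred invariant_subalg.

Record weyl_invariants : Type :=
  WeylInvariant { invariant_val :> weyl k n; _ : invariant_val \in invariant_pred }.

HB.instance Definition _ := [isSub for invariant_val].
HB.instance Definition _ := [Choice of weyl_invariants by <:].
HB.instance Definition _ := [SubChoice_isSubAlgebra of weyl_invariants by <:].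

End TorusAction.

(* With columns numbered from 0, the 1st, 3rd, ... columns are (1, 0)^T and
   the 2nd, 4th, ... columns are (0, 1)^T. *)
Definition alternating_mx (n : nat) : 'M[int]_(2, n) :=
  \matrix_(i < 2, j < n) (nat_of_ord i == odd j :> nat)%:R.

Lemma alternating_weight (k : fieldType) (n : nat) (t : torus k 2) (j : 'I_n) :
  torus_weight (alternating_mx n) t j = val (t (if odd j then ord_max else ord0)).
Proof.
rewrite /torus_weight !big_ord_recl big_ord0 mulr1 !mxE /=.
have -> : lift ord0 ord0 = ord_max :> 'I_2 by apply/val_inj.
by case: (odd j); rewrite /= ?expr0z ?expr1z ?mul1r ?mulr1.
Qed.

(* Main.v *)
From HB Require Import structures.
Require Import Defs.
From mathcomp Require Import all_boot all_order all_algebra.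
From mathcomp Require Import boolp classical_sets functions.
From mathcomp Require Import reals ereal topology normedtype sequences exp.
From mathcomp Require Import -(notations) mpoly.
From mathcomp Require Import zify ring.

(* An invariant operator is written uniquely in normal order, as a combination
   of the x^a d^b where a and b have the same degree on each of the two classes
   of variables; call such (a, b) balanced.  Leading monomials are
   multiplicative, and if (a, b) <= (a', b') are balanced then so is the
   difference, hence Dickson's lemma makes the ring Noetherian.  Balance
   removes two of the 2n degrees of freedom, which gives the growth exponent
   2n - 2.

   The ring acts faithfully on polynomials and preserves their degree, so it has
   enough finite dimensional modules.  Let M be a finite dimensional module,
   E i j = x_i d_j with i and j in the same class, and h_i = E i i.  E i j
   shifts the eigenvalues of h_i, so it is nilpotent on M for i <> j, and
   E j i ^ N * E i j ^ N = P(h_j) Q(h_i) with P and Q coprime.  As P(h_j) Q(h_i)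
   and P(h_i) Q(h_j) vanish on M, so does P(h_i) Q(h_i), which has simple integer
   roots: M is spanned by weight vectors, and the weights of a weight space are
   all nonnegative or all negative on each class (this is where a class needs
   two variables).  Then the E i j act injectively in the direction of the
   original weight, so each weight vector generates a simple module. *)

Set Implicit Arguments.
Unset Strict Implicit.
Unset Printing Implicit Defensive.

Import Order.TTheory GRing.Theory Num.Theory.
Local Open Scope ring_scope.

Local Infix "+m" := mnm_add (at level 50, left associativity).
Local Infix "-m" := mnm_sub (at level 50, left associativity).
Local Infix "<=m" := lem (at level 70).
Local Notation "p @_ m" := (mcoeff m p)
  (at level 3, m at level 2, left associativity, format "p @_ m").
Local Notation msize p := (@mmeasure _ _ mdeg p).

(** * Normal ordering in the Weyl algebra *)
Section NormalOrdering.

Variables (k : fieldType) (n : nat).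

Local Notation pol := (mpoly n k).
Local Notation W := (weyl k n).
Local Notation mon := (multinom (n + n)).
Local Notation sym := (mpoly (n + n) k).

Lemma weyl_ext (a b : W) :
  (forall m, a (mpolyX k m) = b (mpolyX k m)) -> a = b.
Proof. by move=> ab; apply/weyl_eqP/eq_linear_mpoly => //; exact: weyl_linear. Qed.

Lemma weylDE (a b : W) p : (a + b) p = a p + b p.
Proof. by []. Qed.

Lemma weylZE c (a : W) p : (c *: a) p = c *: a p.
Proof. by []. Qed.

Lemma weylME (a b : W) p : (a * b) p = a (b p).
Proof. by []. Qed.

Lemma weyl0E p : (0 : W) p = 0.
Proof. by []. Qed.

Lemma weyl_sumE (I : Type) (r : seq I) (P : pred I) (F : I -> W) p :
  (\sum_(i <- r | P i) F i) p = \sum_(i <- r | P i) F i p.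
Proof. by elim/big_rec2: _ => // i u v _ <-. Qed.

Lemma weylZr (a : W) c p : a (c *: p) = c *: a p.
Proof.
by have := congr1 (fun b : W => b p) (weyl_scaleAr c a 1).
Qed.

Lemma weyl_sumr (I : Type) (r : seq I) (P : pred I) (F : I -> pol) (a : W) :
  a (\sum_(i <- r | P i) F i) = \sum_(i <- r | P i) a (F i).
Proof.
apply: (big_morph a) => [p q|].
  by have := weyl_linear a 1 p q; rewrite !scale1r.
by have := weylZr a 0 0; rewrite !scale0r.
Qed.

Definition xpart (m : mon) : multinom n :=
  Multinom [tuple m (lshift n i) | i < n].
Definition dpart (m : mon) : multinom n :=
  Multinom [tuple m (rshift n i) | i < n].
Definition xdpart (a b : multinom n) : mon :=
  Multinom [tuple match fintype.split i with inl j => a j | inr j => b j end | i < n + n].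

Lemma xpartE m i : xpart m i = m (lshift n i).
Proof. exact: mnmE. Qed.

Lemma dpartE m i : dpart m i = m (rshift n i).
Proof. exact: mnmE. Qed.

Lemma xdpartK m : xdpart (xpart m) (dpart m) = m.
Proof.
apply/mnmP => i; rewrite mnmE -[in RHS](splitK i).
by case: fintype.split => j /=; rewrite ?xpartE ?dpartE.
Qed.

Lemma xdpart_l a b i : xdpart a b (lshift n i) = a i.
Proof. by rewrite mnmE -[lshift n i]/(unsplit (inl i)) unsplitK. Qed.

Lemma xdpart_r a b i : xdpart a b (rshift n i) = b i.
Proof. by rewrite mnmE -[rshift n i]/(unsplit (inr i)) unsplitK. Qed.

Lemma xpart_xd a b : xpart (xdpart a b) = a.
Proof. by apply/mnmP => i; rewrite xpartE xdpart_l. Qed.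

Lemma dpart_xd a b : dpart (xdpart a b) = b.
Proof. by apply/mnmP => i; rewrite dpartE xdpart_r. Qed.

Lemma xpartD m1 m2 : xpart (m1 +m m2) = xpart m1 +m xpart m2.
Proof. by apply/mnmP => i; rewrite !(mnmDE, xpartE). Qed.

Lemma dpartD m1 m2 : dpart (m1 +m m2) = dpart m1 +m dpart m2.
Proof. by apply/mnmP => i; rewrite !(mnmDE, dpartE). Qed.

Lemma mdeg_xd m : mdeg m = (mdeg (xpart m) + mdeg (dpart m))%N.
Proof.
rewrite !mdegE big_split_ord /=.
by congr (_ + _)%N; apply: eq_bigr => i _; rewrite ?xpartE ?dpartE.
Qed.

Definition xdop (m : mon) : W :=
  (\prod_(i < n) weylQ k i ^+ xpart m i) * (\prod_(i < n) weylP k i ^+ dpart m i).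

Arguments xdop : simpl never.

Lemma xdopE m p : xdop m p = mpolyX k (xpart m) * mderivm (dpart m) p.
Proof.
have Qe (i : 'I_n) e (q : pol) : (weylQ k i ^+ e) q = mpolyX k (mnm1 i) ^+ e * q.
  elim: e => [|e IH]; first by rewrite expr0 mul1r.
  by rewrite !exprS weylME IH /= /mulX mulrA.
have Pe (i : 'I_n) e (q : pol) : (weylP k i ^+ e) q = iter e (mderiv i) q.
  by elim: e => [|e IH] //; rewrite exprS weylME IH.
rewrite /xdop weylME.
have -> : (\prod_(i < n) weylP k i ^+ dpart m i : W) p = mderivm (dpart m) p.
  rewrite /mderivm [index_enum _]unlock -enumT.
  by elim: (enum 'I_n) => [|i r IH] /=; rewrite ?big_nil ?big_cons // weylME Pe IH.
rewrite mpolyXE_id.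
elim: (index_enum _) => [|i r IH]; rewrite ?big_nil ?mul1r ?big_cons //.
by rewrite weylME Qe IH mulrA.
Qed.

Lemma xdopX m g : xdop m (mpolyX k g) =
  (\prod_(i < n) g i ^_ dpart m i)%:R *: mpolyX k (xpart m +m (g -m dpart m)).
Proof. by rewrite xdopE mderivmX -scalerAr mpolyXD. Qed.

Definition Op (P : sym) : W := \sum_(m <- msupp P) P@_m *: xdop m.

Arguments Op : simpl never.

Lemma Opw P K : (msize P <= K)%N ->
  Op P = \sum_(m : bmultinom (n + n) K) P@_(bmnm m) *: xdop m.
Proof.
move=> PK; rewrite /Op.
rewrite (bigID (fun m : bmultinom _ _ => bmnm m \in msupp P)) /=.
rewrite [X in _ + X]big1 ?addr0; last first.
  by move=> m /= mP; rewrite (memN_msupp_eq0 mP) scale0r.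
rewrite -[RHS]big_filter; set s := [seq _ <- index_enum _ | _].
rewrite -[RHS](big_map (@bmnm _ _) xpredT (fun m => P@_m *: xdop m)).
apply: perm_big; apply: uniq_perm.
- exact: msupp_uniq.
- rewrite map_inj_uniq ?filter_uniq ?index_enum_uniq //; exact: val_inj.
move=> m; apply/idP/mapP => [mP|[m' + ->]]; last first.
  by rewrite mem_filter => /andP[].
have mK : (mdeg m < K)%N by apply: leq_trans PK; exact: msize_mdeg_lt.
by exists (BMultinom mK) => //; rewrite mem_filter mP mem_index_enum.
Qed.

Fact Op_is_linear : linear Op.
Proof.
move=> c P Q; pose K := maxn (msize (c *: P + Q)) (maxn (msize P) (msize Q)).
rewrite !(@Opw _ K) ?leq_max ?leqnn ?orbT // scaler_sumr -big_split.
by apply: eq_bigr => m _; rewrite mcoeffD mcoeffZ scalerDl scalerA.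
Qed.

HB.instance Definition _ := GRing.isLinear.Build k sym W *:%R Op Op_is_linear.

Lemma OpD P Q : Op (P + Q) = Op P + Op Q.
Proof. exact: raddfD. Qed.

Lemma OpZ c P : Op (c *: P) = c *: Op P.
Proof. exact: linearZ. Qed.

Lemma OpX m : Op (mpolyX k m) = xdop m.
Proof. by rewrite /Op msuppX big_seq1 mcoeffX eqxx scale1r. Qed.

Lemma OpE P p : Op P p = \sum_(m <- msupp P) P@_m *: xdop m p.
Proof. by rewrite /Op weyl_sumE. Qed.

Lemma xdop0 : xdop (@mnm0 _) = 1.
Proof.
by rewrite /xdop !big1 ?mul1r // => i _; rewrite ?xpartE ?dpartE mnm0E expr0.
Qed.

Lemma weylQ_Op i P :
  weylQ k i * Op P = Op (mpolyX k (mnm1 (lshift n i)) * P).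
Proof.
elim/mpolyind: P => [|c m p _ _ ih]; first by rewrite mulr0 !raddf0 mulr0.
rewrite mulrDr 2!OpD mulrDr ih; congr (_ + _).
rewrite -scalerAr !OpZ -scalerAr; congr (_ *: _).
rewrite -mpolyXD !OpX; apply/weyl_eqP => q; rewrite weylME !xdopE /= /mulX mulrA.
rewrite -mpolyXD xpartD dpartD; congr (mpolyX _ (_ +m _) * mderivm _ _).
  by apply/mnmP => j; rewrite xpartE !mnm1E (inj_eq (@lshift_inj _ _)).
by apply/mnmP => j; rewrite mnmDE !dpartE mnm1E eq_lrshift.
Qed.

Lemma weylP_Op i P : weylP k i * Op P =
  Op (mpolyX k (mnm1 (rshift n i)) * P + mderiv (lshift n i) P).
Proof.
elim/mpolyind: P => [|c m p _ _ ih].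
  by rewrite mulr0 mderiv0 addr0 !raddf0 mulr0.
rewrite mulrDr mderivD addrACA 2!OpD mulrDr ih; congr (_ + _).
rewrite -scalerAr mderivZ -scalerDr !OpZ -scalerAr; congr (_ *: _).
rewrite -mpolyXD mderivX OpD OpZ !OpX.
apply/weyl_eqP => q; rewrite weylME weylDE weylZE !xdopE /= /derX mderivM.
rewrite addrC mderivX -scalerAl xpartE; congr (_ + _).
  rewrite xpartD dpartD.
  have -> : xpart (mnm1 (rshift n i)) = @mnm0 n.
    by apply/mnmP => j; rewrite xpartE mnm1E mnm0E eq_rlshift.
  have -> : dpart (mnm1 (rshift n i)) = mnm1 i.
    by apply/mnmP => j; rewrite dpartE !mnm1E (inj_eq (@rshift_inj _ _)).
  by rewrite add0m addmC mderivmDm mderivmU1m.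
congr (_ *: (mpolyX _ _ * mderivm _ _)).
  by apply/mnmP => j; rewrite !(mnmBE, xpartE) !mnm1E (inj_eq (@lshift_inj _ _)).
by apply/mnmP => j; rewrite !(mnmBE, dpartE) !mnm1E eq_lrshift subn0.
Qed.

Lemma weyl_op_Op (f : pol -> pol) : weyl_op f -> exists P, f =1 Op P.
Proof.
have gen (P : sym) : forall Q, exists R, Op P * Op Q = Op R.
  elim/mpolyind: P => [|c m p _ _ ih] Q.
    by exists 0; rewrite raddf0 mul0r.
  have [R1 R1E] := ih Q.
  suff [R RE] : exists R, xdop m * Op Q = Op R.
    exists (c *: R + R1).
    by rewrite !linearP /= OpX mulrDl -scalerAl RE R1E.
  rewrite /xdop -mulrA.
  have [R1' ->] : exists R, (\prod_i weylP k i ^+ (dpart m) i) * Op Q = Op R.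
    elim: (index_enum _) => [|i r [R IH]]; first by exists Q; rewrite big_nil mul1r.
    rewrite big_cons -mulrA IH; elim: (dpart m i) => [|e [R' IHe]].
      by exists R; rewrite mul1r.
    by rewrite exprS -mulrA IHe weylP_Op; eexists.
  elim: (index_enum _) => [|i r [R IH]]; first by exists R1'; rewrite big_nil mul1r.
  rewrite big_cons -mulrA IH; elim: (xpart m i) => [|e [R' IHe]].
    by exists R; rewrite mul1r.
  by rewrite exprS -mulrA IHe weylQ_Op; eexists.
elim=> {f} [|i|i|c f g _ [P hP] _ [Q hQ]|f g _ [P hP] _ [Q hQ]].
- by exists 1 => p; rewrite -mpolyX0 OpX xdop0.
- exists (mpolyX k (mnm1 (lshift n i)) * 1) => p.
  by rewrite -weylQ_Op -mpolyX0 OpX xdop0 mulr1.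
- exists (mpolyX k (mnm1 (rshift n i)) * 1 + mderiv (lshift n i) 1) => p.
  by rewrite -weylP_Op -mpolyX0 OpX xdop0 mulr1.
- by exists (c *: P + Q) => p; rewrite linearP /= !fctE hP hQ.
- by have [R RE] := gen P Q; exists R => p; rewrite -RE /= hQ hP.
Qed.

End NormalOrdering.

(** * Leading monomials and invariance *)

Arguments weyl_fun : simpl never.

Section PolynomialSize.

Variables (R : fieldType) (n : nat).
Implicit Types (p q : mpoly n R) (m : multinom n).

Lemma mcoeff_sum (I : Type) (r : seq I) (P : pred I) (F : I -> mpoly n R) m :
  (\sum_(i <- r | P i) F i)@_m = \sum_(i <- r | P i) (F i)@_m.
Proof. exact: raddf_sum. Qed.

Lemma msize_leP p d :
  reflect (forall m, m \in msupp p -> (mdeg m < d)%N) (msize p <= d)%N.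
Proof.
rewrite msizeE; apply: (iffP (bigmax_leqP_seq _ _ _ _)) => h m mp; first exact: h.
by move=> _; exact: h.
Qed.

Lemma msize_mderiv i p : (msize (mderiv i p) <= (msize p).-1)%N.
Proof.
apply/msize_leP => m; rewrite mcoeff_msupp mcoeff_deriv => h.
have : m +m mnm1 i \in msupp p.
  by rewrite mcoeff_msupp; apply: contra h => /eqP ->; rewrite mul0rn.
by move/msize_mdeg_lt; rewrite mdegD mdeg1; lia.
Qed.

Lemma msizeM_leq p q : (msize (p * q) <= (msize p).-1 + msize q)%N.
Proof.
have [->|p0] := eqVneq p 0; first by rewrite mul0r mmeasure0.
have [->|q0] := eqVneq q 0; first by rewrite mulr0 mmeasure0.
rewrite msizeM_proper ?mulf_neq0 ?mleadc_eq0 //.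
by have := mpolySpred mdeg p0; lia.
Qed.

Lemma msizeM p q : p != 0 -> q != 0 -> msize (p * q) = (msize p + msize q).-1.
Proof. by move=> p0 q0; rewrite msizeM_proper // mulf_neq0 // mleadc_eq0. Qed.

Lemma mleadM p q : p != 0 -> q != 0 -> mlead (p * q) = mlead p +m mlead q.
Proof. by move=> p0 q0; rewrite mleadM_proper // mulf_neq0 // mleadc_eq0. Qed.

Lemma mlead_addl p q : (msize q < msize p)%N -> mlead (p + q) = mlead p.
Proof.
have [->|q0] := eqVneq q 0; first by rewrite addr0.
move=> qp; have p0 : p != 0 by rewrite -msize_poly_eq0; lia.
by apply/mleadDl/lt_mdeg_ltmc; rewrite -ltnS !mlead_deg.
Qed.

End PolynomialSize.

Section Symbol.

Variables (k : fieldType) (n : nat).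

Local Notation W := (weyl k n).
Local Notation mon := (multinom (n + n)).
Local Notation sym := (mpoly (n + n) k).

Definition has_lead (a : W) (m : mon) := forall Q,
  exists2 R : sym, a * Op Q = Op (mpolyX k m * Q + R)
           & (msize R <= mdeg m + (msize Q).-1)%N.

Lemma has_lead1 : has_lead 1 (@mnm0 _).
Proof.
move=> Q; exists 0; last by rewrite mmeasure0.
by rewrite addr0 mpolyX0 !mul1r.
Qed.

Lemma has_leadM a b m1 m2 :
  has_lead a m1 -> has_lead b m2 -> has_lead (a * b) (m1 +m m2).
Proof.
move=> ha hb Q; have [R RE Rs] := hb Q.
have [R' RE' Rs'] := ha (mpolyX k m2 * Q + R).
exists (mpolyX k m1 * R + R').
  by rewrite -mulrA RE RE' mulrDr mpolyXD mulrA addrA.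
apply: (leq_trans (msizeD_le _ _)); rewrite geq_max.
have h := msizeM_leq (mpolyX k m1) R.
have h1 := msizeM_leq (mpolyX k m2) Q.
have h2 := msizeD_le (mpolyX k m2 * Q) R.
rewrite !msizeX /= in h h1.
rewrite mdegD; apply/andP; split; first lia.
apply: (leq_trans Rs'); rewrite -addnA leq_add2l.
move: h2 h1 Rs; set u := msize (_ * Q); set v := msize (_ * Q + R).
by case: (msize Q) => [|s] /=; lia.
Qed.

Lemma has_leadX a m e : has_lead a m -> has_lead (a ^+ e) (mnm_muln m e).
Proof.
move=> ha; elim: e => [|e IH]; first by rewrite mulm0n; exact: has_lead1.
by rewrite exprS mulmS; exact: has_leadM.
Qed.

Lemma has_lead_prod (I : Type) (r : seq I) (F : I -> W) (G : I -> mon) :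
  (forall i, has_lead (F i) (G i)) ->
  has_lead (\prod_(i <- r) F i) (\big[mnm_add/@mnm0 _]_(i <- r) G i).
Proof.
move=> h; elim/big_rec2: _ => [|i m a _ IH]; first exact: has_lead1.
exact: has_leadM.
Qed.

Lemma has_leadQ i : has_lead (weylQ k i) (mnm1 (lshift n i)).
Proof. by move=> Q; exists 0; rewrite ?mmeasure0 // weylQ_Op addr0. Qed.

Lemma has_leadP i : has_lead (weylP k i) (mnm1 (rshift n i)).
Proof.
move=> Q; exists (mderiv (rshift n i) 0 + mderiv (lshift n i) Q).
  by rewrite weylP_Op mderiv0 add0r.
by rewrite mderiv0 add0r; apply: (leq_trans (msize_mderiv _ _)); exact: leq_addl.
Qed.

Lemma has_lead_xdop m : has_lead (xdop k m) m.
Proof.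
have {2}-> : m = (\big[mnm_add/@mnm0 _]_(i < n) mnm_muln (mnm1 (lshift n i)) (xpart m i))
      +m (\big[mnm_add/@mnm0 _]_(i < n) mnm_muln (mnm1 (rshift n i)) (dpart m i)).
  rewrite {1}[m]multinomUE_id big_split_ord; congr (_ +m _);
  by apply: eq_bigr => i _; rewrite ?xpartE ?dpartE.
by apply: has_leadM; apply: has_lead_prod => i; apply: has_leadX;
  [exact: has_leadQ|exact: has_leadP].
Qed.

Lemma OpM P Q : exists2 R : sym, Op P * Op Q = Op (P * Q + R)
           & (msize R <= (msize P).-1 + (msize Q).-1)%N.
Proof.
have /choice[R RP] m : exists R : sym, xdop k m * Op Q = Op (mpolyX k m * Q + R) /\
    (msize R <= mdeg m + (msize Q).-1)%N.
  by have [R ? ?] := has_lead_xdop m Q; exists R.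
exists (\sum_(m <- msupp P) P@_m *: R m).
  transitivity (Op (\sum_(m <- msupp P) P@_m *: (mpolyX k m * Q + R m))).
    rewrite raddf_sum /= [in LHS]/Op mulr_suml; apply: eq_bigr => m _.
    by rewrite OpZ -scalerAl; have [->] := RP m.
  congr Op; rewrite {3}[P]mpolyE mulr_suml -big_split.
  by apply: eq_bigr => m _; rewrite scalerDr scalerAl.
apply: (leq_trans (msize_sum _ _ _)); apply/bigmax_leqP_seq => m mP _.
apply: (leq_trans (msizeZ_le _ _)).
have [_ h] := RP m; apply: (leq_trans h); rewrite leq_add2r.
by have := msize_mdeg_lt mP; case: (msize P).
Qed.

Hypothesis char0 : [pchar k] =i pred0.

Lemma natr_eq0_char0 d : (d%:R == 0 :> k) = (d == 0)%N.
Proof. by move/pcharf0P: char0 => ->. Qed.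

Lemma natr_inj_char0 : injective (fun d : nat => d%:R : k).
Proof.
have h d e : (d <= e)%N -> d%:R = e%:R :> k -> d = e.
  move=> de dE; apply/eqP; rewrite eqn_leq de /= -subn_eq0 -natr_eq0_char0.
  by rewrite natrB // dE subrr.
by move=> d e; case/orP: (leq_total d e) => ? ?; [|symmetry]; exact: h.
Qed.

Lemma Op_inj : injective (@Op k n).
Proof.
apply: raddf_inj => P P0; apply/eqP; apply: contraT => Pn0.
have ex : exists b, has (fun m => mdeg (dpart m) == b) (msupp P).
  exists (mdeg (dpart (mlead P))); apply/hasP; exists (mlead P) => //.
  exact: mlead_supp.
case: (ex_minnP ex) => b /hasP[m mP /eqP mb] bmin.
have := congr1 (fun a : W => (a (mpolyX k (dpart m)))@_(xpart m)) P0.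
rewrite weyl0E mcoeff0 OpE mcoeff_sum (bigD1_seq m) ?msupp_uniq //=.
rewrite [X in _ + X]big1_seq => [|m' /andP[m'm m'P]].
  rewrite addr0 mcoeffZ xdopX mcoeffZ mcoeffX => /eqP.
  rewrite (_ : _ +m _ = xpart m) ?eqxx ?mulr1; last first.
    by apply/mnmP => i; rewrite mnmDE mnmBE subnn addn0.
  rewrite mulf_eq0 -[_ == 0]negbK -mcoeff_msupp mP /= natr_eq0_char0.
  by rewrite gtn_eqF //; apply: prodn_gt0 => i; rewrite ffactnn fact_gt0.
rewrite mcoeffZ xdopX mcoeffZ mcoeffX.
have [le|] := boolP (dpart m' <=m dpart m); last first.
  move=> /mnm_lepP; rewrite -existsNE => -[i /negP]; rewrite -ltnNge => lt.
  by rewrite (bigD1 i) //= ffact_small // mul0n mul0r mulr0.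
have eqd : dpart m' = dpart m.
  have h : (mdeg (dpart m) <= mdeg (dpart m'))%N.
    by rewrite mb; apply: bmin; apply/hasP; exists m'.
  have h1 := submK le; have := congr1 (@mdeg _) h1; rewrite mdegD => h2.
  have /eqP : mdeg (dpart m -m dpart m') = 0%N by lia.
  by rewrite mdeg_eq0 => /eqP e; rewrite -h1 e add0m.
rewrite eqd (_ : dpart m -m dpart m = @mnm0 _) ?addm0; last first.
  by apply/mnmP => i; rewrite mnmBE subnn mnm0E.
case: eqP => [eqx|]; last by rewrite !mulr0.
by case/eqP: m'm; rewrite -[m']xdpartK -[m]xdpartK eqd eqx.
Qed.

Definition balanced (m : mon) := [forall c : bool,
  (\sum_(i < n | odd i == c) m (lshift n i))%N ==
  (\sum_(i < n | odd i == c) m (rshift n i))%N].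

Lemma torus_act_xdop (t : torus k 2) m :
  torus_act (alternating_mx n) t (xdop k m) =
  (\prod_(j < n) torus_weight (alternating_mx n) t j ^+ m (lshift n j) *
   \prod_(j < n) (torus_weight (alternating_mx n) t j)^-1 ^+ m (rshift n j))
    *: xdop k m.
Proof.
rewrite /xdop rmorphM !rmorph_prod /= -!scalerA.
rewrite (eq_bigr (fun j => torus_weight (alternating_mx n) t j ^+ m (lshift n j) *:
   (weylQ k j ^+ xpart m j))); last first.
  by move=> j _; rewrite rmorphXn /= torus_actQ exprZn xpartE.
rewrite [X in _ * X](eq_bigr (fun j =>
   (torus_weight (alternating_mx n) t j)^-1 ^+ m (rshift n j) *:
   (weylP k j ^+ dpart m j))); last first.
  by move=> j _; rewrite rmorphXn /= torus_actP exprZn dpartE.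
by rewrite !scaler_prod -scalerAl -scalerAr.
Qed.

Lemma torus_weight_prod (t : torus k 2) (F : 'I_n -> nat) (f : k -> k) :
  \prod_(j < n) f (torus_weight (alternating_mx n) t j) ^+ F j =
  f (val (t ord0)) ^+ (\sum_(j < n | odd j == false) F j) *
  f (val (t ord_max)) ^+ (\sum_(j < n | odd j == true) F j).
Proof.
rewrite (bigID (fun j : 'I_n => odd j == false)) /=.
congr (_ * _); rewrite expr_sum; apply: eq_big => j; rewrite ?alternating_weight //.
- by move=> /eqP ->.
- by case: odd.
- by case: odd.
Qed.

Lemma invariantP (P : sym) :
  reflect (forall m, m \in msupp P -> balanced m)
          (Op P \in invariant_pred (alternating_mx n)).
Proof.
apply: (iffP idP) => [/asboolP h m mP|h]; last first.
  apply/asboolP => t; rewrite /Op raddf_sum /= !big_seq; apply: eq_bigr => m mP.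
  rewrite linearZ /= torus_act_xdop (torus_weight_prod _ _ id).
  rewrite (torus_weight_prod _ _ (fun x => x^-1)).
  have /forallP hb := h m mP; rewrite -!(eqP (hb _)) !exprVn mulrACA.
  by rewrite !divff ?expf_neq0 ?(valP (t _)) // mul1r scale1r.
apply/forallP => c.
have two0 : 2%:R != 0 :> k by rewrite natr_eq0_char0.
pose t : torus k 2 := fun i => if (i == ord_max) == c then exist _ 2%:R two0
   else exist _ 1 (oner_neq0 _).
pose w (m' : mon) : k :=
  \prod_(j < n) torus_weight (alternating_mx n) t j ^+ m' (lshift n j) *
  \prod_(j < n) (torus_weight (alternating_mx n) t j)^-1 ^+ m' (rshift n j).
have /Op_inj PE : Op P = Op (\sum_(m' <- msupp P) (P@_m' * w m') *: mpolyX k m').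
  rewrite -[LHS](h t) raddf_sum [RHS]raddf_sum /=; apply: eq_bigr => m' _.
  by rewrite linearZ /= torus_act_xdop scalerA OpZ OpX.
have := congr1 (mcoeff m) PE; rewrite mcoeff_sum (bigD1_seq m) ?msupp_uniq //=.
rewrite big1 => [|m' m'm]; last by rewrite mcoeffZ mcoeffX (negPf m'm) mulr0.
rewrite addr0 mcoeffZ mcoeffX eqxx mulr1 -[LHS]mulr1 => /mulfI.
rewrite -mcoeff_msupp mP => /(_ isT); rewrite /w (torus_weight_prod _ _ id).
rewrite (torus_weight_prod _ _ (fun x => x^-1)) mulrACA /t.
set A := (\sum_(_ < n | _ == c) _)%N; set B := (\sum_(_ < n | _ == c) _)%N.
suff : 1 = 2%:R ^+ A * 2%:R^-1 ^+ B :> k -> A == B.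
  move=> h1 h2; apply: h1; move: h2; rewrite /A /B; case: (c) => /=;
  by rewrite !invr1 !expr1n ?mulr1 ?mul1r.
rewrite exprVn => e; have : 2%:R ^+ A = 2%:R ^+ B :> k.
  have := congr1 (fun x => x * 2%:R ^+ B) e.
  by rewrite mul1r mulfVK ?expf_neq0.
by rewrite -!natrX => /natr_inj_char0 /eqP; rewrite eqn_exp2l.
Qed.

End Symbol.

(** * The Noetherian property *)

Section SymbolMap.

Variables (k : fieldType) (n : nat).
Hypothesis char0 : [pchar k] =i pred0.

Local Notation mon := (multinom (n + n)).
Local Notation sym := (mpoly (n + n) k).
Local Notation A := (weyl_invariants k (alternating_mx n)).
Implicit Types (a b x y : A) (m : mon) (P Q : sym).

Lemma symb_ex a : exists P, Op P == invariant_val a.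
Proof.
have [P aP] := weyl_op_Op (weyl_opP (invariant_val a)).
by exists P; apply/eqP/weyl_eqP => p; rewrite aP.
Qed.

Definition symb a : sym := xchoose (symb_ex a).

Lemma symbK a : Op (symb a) = invariant_val a.
Proof. exact/eqP/(xchooseP (symb_ex a)). Qed.

Lemma symbP a P : invariant_val a = Op P -> symb a = P.
Proof. by rewrite -symbK => /(Op_inj char0). Qed.

Lemma symb_inj : injective symb.
Proof. by move=> a b ab; apply/val_inj; rewrite /= -!symbK ab. Qed.

Fact symb_is_linear : linear symb.
Proof. by move=> c a b; apply: symbP; rewrite OpD OpZ !symbK. Qed.

HB.instance Definition _ := GRing.isLinear.Build k A sym *:%R symb symb_is_linear.

Lemma symb0 : symb 0 = 0.
Proof. exact: raddf0. Qed.

Lemma symbB a b : symb (a - b) = symb a - symb b.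
Proof. exact: raddfB. Qed.

Lemma symbZ (c : k) a : symb (c *: a) = c *: symb a.
Proof. exact: linearZ. Qed.

Lemma symb_sum (I : Type) (r : seq I) (S : pred I) (F : I -> A) :
  symb (\sum_(i <- r | S i) F i) = \sum_(i <- r | S i) symb (F i).
Proof. exact: raddf_sum. Qed.

Lemma symb_eq0 a : (symb a == 0) = (a == 0).
Proof. by rewrite -(inj_eq symb_inj) raddf0. Qed.

Lemma symb1 : symb 1 = 1.
Proof. by apply: symbP; rewrite -mpolyX0 OpX xdop0. Qed.

Lemma symb_balanced a m : m \in msupp (symb a) -> balanced m.
Proof.
move=> ma; apply: (invariantP char0 (symb a)) => //.
by rewrite symbK; case: (a).
Qed.

Lemma symb_onto P : (forall m, m \in msupp P -> balanced m) ->
  exists a, symb a = P.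
Proof.
move=> /(invariantP char0) h; exists (WeylInvariant h); exact: symbP.
Qed.

Lemma symbM a b : exists2 R : sym, symb (a * b) = symb a * symb b + R
  & (msize R <= (msize (symb a)).-1 + (msize (symb b)).-1)%N.
Proof.
by have [R RE Rs] := OpM (symb a) (symb b); exists R => //;
   apply: symbP; rewrite -RE !symbK.
Qed.

Lemma symbM_lead a b : a != 0 -> b != 0 ->
  [/\ a * b != 0, mlead (symb (a * b)) = mlead (symb a) +m mlead (symb b)
    & msize (symb (a * b)) = (msize (symb a) + msize (symb b)).-1].
Proof.
rewrite -!symb_eq0 => a0 b0; have [R -> Rs] := symbM a b.
have lt : (msize R < msize (symb a * symb b))%N.
  rewrite msizeM //; apply: (leq_ltn_trans Rs).
  move: a0 b0; rewrite -!(msize_poly_eq0 (symb _)).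
  by case: (msize _) => // d _; case: (msize _) => // e _ /=; rewrite addnS.
have le := mlead_addl lt.
have n0 : symb a * symb b + R != 0.
  apply/eqP => /(canRL (addrK R)); rewrite sub0r => e.
  by move: lt; rewrite e mmeasureN ltnn.
split=> //; first by rewrite le mleadM.
apply/eqP; rewrite -(msizeM a0 b0) -!mlead_deg ?mulf_neq0 //.
by rewrite le.
Qed.

Lemma balanced_sub m1 m2 : balanced m1 -> balanced m2 -> m1 <=m m2 ->
  balanced (m2 -m m1).
Proof.
move=> /forallP b1 /forallP b2 le; apply/forallP => c.
rewrite -(eqn_add2r (\sum_(i < n | odd i == c) m1 (lshift n i))).
rewrite {2}(eqP (b1 c)) -!big_split /=.
have h i : ((m2 -m m1) i + m1 i)%N = m2 i by rewrite -mnmDE submK.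
under eq_bigr do rewrite h.
by under [X in _ == X]eq_bigr do rewrite h; exact: b2.
Qed.

Lemma mlead_cancel P Q : P != 0 -> Q != 0 -> mlead P = mlead Q ->
  let S := P - (P@_(mlead P) / Q@_(mlead Q)) *: Q in
  S != 0 -> (mlead S < mlead P)%O.
Proof.
move=> P0 Q0 PQ S S0.
have le : (mlead S <= mlead P)%O.
  apply: (le_trans (mleadB_le _ _)); rewrite leUx lexx /= PQ; exact: mleadZ_le.
rewrite lt_neqAle le andbT; apply: contra S0 => /eqP e.
rewrite -mleadc_eq0 e mcoeffB mcoeffZ PQ mulfVK ?subrr //.
by rewrite mleadc_eq0.
Qed.

End SymbolMap.

Section Dickson.

Lemma nondecreasing_subseq (g : nat -> nat) : exists2 phi : nat -> nat,
  {homo phi : a b / (a < b)%N} & {homo g \o phi : a b / (a <= b)%N}.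
Proof.
have /choice[nxt nxtP] N : exists j, (N <= j)%N /\
    forall j', (N <= j')%N -> (g j <= g j')%N.
  have ex : exists v, `[< exists2 j, (N <= j)%N & g j = v >].
    by exists (g N); apply/asboolP; exists N.
  case: (ex_minnP ex) => v /asboolP[j Nj <-] vmin; exists j; split=> // j' Nj'.
  by apply: vmin; apply/asboolP; exists j'.
pose phi := fix phi a := if a is a'.+1 then nxt (phi a').+1 else nxt 0.
have phiS a : (phi a < phi a.+1)%N by case: (nxtP (phi a).+1).
have phi_lt : {homo phi : a b / (a < b)%N} by apply: homo_ltn => // ? ? ?; exact: ltn_trans.
exists phi => // a b; rewrite leq_eqVlt => /predU1P[-> //|ab] /=.
case: a ab => [|a] ab; first by case: (nxtP 0) => _; exact.
case: (nxtP (phi a).+1) => _; apply; apply: phi_lt; exact: ltnW.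
Qed.

Lemma dickson d (f : nat -> multinom d) : exists i j, (i < j)%N /\ f i <=m f j.
Proof.
have [phi phi_lt phi_le] : exists2 phi : nat -> nat, {homo phi : a b / (a < b)%N} &
    forall i, i \in enum 'I_d -> {homo (fun a => f (phi a) i) : a b / (a <= b)%N}.
  elim: (enum 'I_d) => [|i r [phi phi_lt phi_le]]; first by exists id.
  have [psi psi_lt psi_le] := nondecreasing_subseq (fun a => f (phi a) i).
  exists (phi \o psi) => [a b ab|j]; first exact/phi_lt/psi_lt.
  rewrite inE => /predU1P[->|jr] a b ab; first exact: psi_le.
  apply: phi_le => //; move: ab; rewrite leq_eqVlt => /predU1P[-> //|ab].
  exact/ltnW/psi_lt.
exists (phi 0), (phi 1%N); split; first exact: phi_lt.
by apply/mnm_lepP => i; apply: phi_le; rewrite ?mem_enum.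
Qed.

End Dickson.

Section NoetherianInvariants.

Variables (k : fieldType) (n : nat).
Hypothesis char0 : [pchar k] =i pred0.
Local Notation A := (weyl_invariants k (alternating_mx n)).

Lemma mlead_min (S : A -> Prop) : (exists x, S x) ->
  exists2 x, S x & forall y, S y -> ~~ (mlead (symb y) < mlead (symb x))%O.
Proof.
case=> x Sx; apply: contrapT => nex.
have : forall m (y : A), mlead (symb y) = m -> ~ S y.
  apply: (well_founded_induction (@ltom_wf _)) => m IH y ym Sy.
  apply: nex; exists y => // z Sz; apply/negP => zy.
  by apply: (IH (mlead (symb z)) _ z) => //; rewrite -ym.
by move/(_ _ x erefl).
Qed.

(* [act] is left or right multiplication. *)
Lemma chain_stabilizes (act : A -> A -> A) :
    (forall a x, a != 0 -> x != 0 -> act a x != 0 /\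
       mlead (symb (act a x)) = mlead (symb a) +m mlead (symb x)) ->
  forall I : nat -> {pred A},
    (forall i, 0 \in I i) ->
    (forall i x y, x \in I i -> y \in I i -> x + y \in I i) ->
    (forall i c x, x \in I i -> c *: x \in I i) ->
    (forall i a x, x \in I i -> act a x \in I i) ->
    (forall i, {subset I i <= I i.+1}) ->
  exists N : nat, forall i : nat, (N <= i)%N -> I i =i I N.
Proof.
move=> act_lead I I0 ID IZ IM Iincr; apply: contrapT => nstab.
have Imon i j : (i <= j)%N -> {subset I i <= I j}.
  by move=> /subnKC <-; elim: (j - i)%N => [|e IH] x xI; rewrite ?addn0 ?addnS //;
     apply/Iincr/IH.
have /choice[nx nxP] N : exists w : nat * A, [/\ (N <= w.1)%N, w.2 \in I w.1,
    w.2 \notin I N & forall y, y \in I w.1 -> y \notin I N ->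
      ~~ (mlead (symb y) < mlead (symb w.2))%O].
  have [i [Ni [x xi xN]]] : exists i, (N <= i)%N /\ exists2 x, x \in I i & x \notin I N.
    apply: contrapT => nex; apply: nstab; exists N => i Ni x; apply/idP/idP.
      by move=> xi; apply: contrapT => /negP xN; apply: nex; exists i; split=> //; exists x.
    exact: Imon.
  have [|y [yi yN] ymin] := @mlead_min (fun x => x \in I i /\ x \notin I N).
    by exists x.
  by exists (i, y); split=> // z zi zN; apply: ymin.
pose N := fix N t := if t is t'.+1 then (nx (N t')).1 else 0%N.
have Nmon s t : (s <= t)%N -> (N s <= N t)%N.
  move=> /subnKC <-; elim: (t - s)%N => [|e IH]; rewrite ?addn0 ?addnS //.
  by apply: (leq_trans IH) => /=; case: (nxP (N (s + e)%N)).
pose x t := (nx (N t)).2.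
have x0 t : x t != 0.
  by apply/eqP => xt; case: (nxP (N t)) => _ _ /negP []; rewrite -/(x t) xt I0.
have [s [t [st le]]] := dickson (fun t => mlead (symb (x t))).
have xlead u : balanced (mlead (symb (x u))).
  by apply: (symb_balanced char0); apply: mlead_supp; rewrite symb_eq0.
have [a aE] : exists a : A, symb a = mpolyX k (mlead (symb (x t)) -m mlead (symb (x s))).
  apply: symb_onto => // m; rewrite msuppX inE => /eqP ->; exact: balanced_sub.
have a0 : a != 0.
  by rewrite -(symb_eq0 char0) aE -msize_poly_eq0 msizeX.
have [b0 blead] := act_lead a (x s) a0 (x0 s).
set b := act a (x s) in b0 blead.
rewrite aE mleadXm submK // in blead.
have bI : b \in I (N t).
  by apply/IM/(@Imon (N s.+1)); [exact: Nmon|case: (nxP (N s))].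
set c := (symb (x t))@_(mlead (symb (x t))) / (symb b)@_(mlead (symb b)).
have cbI : - (c *: b) \in I (N t) by rewrite -scaleN1r; apply: (IZ); apply: (IZ).
case: (nxP (N t)) => Nt xI xnI /(_ (x t - c *: b)).
have yE : symb (x t - c *: b) = symb (x t) - c *: symb b.
  by rewrite symbB // symbZ.
case/(_ _ _)/negP.
- by apply: ID => //; apply: (@Imon (N t)).
- apply: contra xnI => yI; rewrite -/(x t).
  by rewrite -(subrK (c *: b) (x t)); apply: ID => //; apply: IZ.
rewrite yE; apply: mlead_cancel; rewrite ?symb_eq0 // -yE symb_eq0 //.
apply/eqP => y0; move: xnI; rewrite -/(x t) -(subrK (c *: b) (x t)) y0 add0r.
by move/negP; apply; apply: IZ.
Qed.

Lemma noetherian_invariants : noetherian A.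
Proof.
split=> I Isub Iincr.
- apply: (@chain_stabilizes (fun a x => a * x)) => //.
  + by move=> a x a0 x0; have [] := symbM_lead char0 a0 x0.
  + by move=> i; case: (Isub i).
  + move=> i x y xI yI; case: (Isub i) => _ /(_ 1 x y xI yI).
    by rewrite /GRing.scale /= mul1r.
  + move=> i c x xI; case: (Isub i) => I0 /(_ c%:A x 0 xI I0).
    by rewrite addr0 -(mulr_algl c x).
  + move=> i a x xI; case: (Isub i) => I0 /(_ a x 0 xI I0).
    by rewrite addr0.
- apply: (@chain_stabilizes (fun a x => x * a)) => //.
  + move=> a x a0 x0; have [? -> _] := symbM_lead char0 x0 a0.
    by split=> //; rewrite addmC.
  + by move=> i; case: (Isub i).
  + move=> i x y xI yI; case: (Isub i) => _ /(_ 1 x y xI yI).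
    by rewrite scale1r.
  + move=> i c x xI; case: (Isub i) => I0 /(_ c%:A x 0 xI I0).
    by rewrite addr0 -(mulr_algr c x).
  + move=> i a x xI; case: (Isub i) => I0 /(_ a x 0 xI I0).
    by rewrite addr0.
Qed.

End NoetherianInvariants.

(** * Finite dimensional modules *)

Section Semisimplicity.

Variables (R : nzRingType) (M : lmodType R) (I : finType) (v : I -> M).
Hypothesis v_gen : forall x : M, exists a : I -> R, x = \sum_i a i *: v i.
Hypothesis v_simple :
  forall i a, a *: v i != 0 -> exists b, b *: (a *: v i) = v i.

Let span (J : {set I}) : {pred M} :=
  fun x => `[< exists a : I -> R, x = \sum_(i in J) a i *: v i >].

Let spanP (J : {set I}) x :
  reflect (exists a : I -> R, x = \sum_(i in J) a i *: v i) (x \in span J).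
Proof. exact: asboolP. Qed.

Let span_submod (J : {set I}) : submod_closed (span J).
Proof.
split=> [|c x y /spanP[a ->] /spanP[b ->]]; apply/spanP.
  by exists (fun=> 0); rewrite big1 // => i _; rewrite scale0r.
exists (fun i => c * a i + b i); rewrite scaler_sumr -big_split /=.
by apply: eq_bigr => i _; rewrite scalerDl scalerA.
Qed.

Lemma generated_by_simple_completely_reducible : completely_reducible M.
Proof.
move=> S [S0 Sl]; pose free (J : {set I}) := `[< forall x, x \in S -> x \in span J -> x = 0 >].
have free0 : free finset.set0.
  by apply/asboolP => x _ /spanP[a ->]; rewrite big_set0.
have [J /maxsetP[/asboolP Jfree Jmax]] := ex_maxset (ex_intro (fun J => is_true (free J)) _ free0).
have SD x y : x \in S -> y \in S -> x + y \in S.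
  by move=> xS yS; rewrite -[x]scale1r; exact: Sl.
have SZ c x : x \in S -> c *: x \in S.
  by move=> xS; rewrite -[_ *: _]addr0; exact: Sl.
have [T0 Tl] := span_submod J.
have TD x y : x \in span J -> y \in span J -> x + y \in span J.
  by move=> xS yS; rewrite -[x]scale1r; exact: Tl.
have TZ c x : x \in span J -> c *: x \in span J.
  by move=> xS; rewrite -[_ *: _]addr0; exact: Tl.
exists (span J); split=> //.
have sumv i : exists st : M * M, [/\ st.1 \in S, st.2 \in span J & v i = st.1 + st.2].
  have [iJ|iJ] := boolP (i \in J).
    exists (0, v i); split=> //=; last by rewrite add0r.
    apply/spanP; exists (fun j => (j == i)%:R); rewrite (bigD1 i) //= eqxx scale1r.
    by rewrite big1 ?addr0 // => j /andP[_ /negPf ->]; rewrite scale0r.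
  have : ~ forall x, x \in S -> x \in span (i |: J) -> x = 0.
    move=> /asboolP h; have := Jmax _ h (finset.subsetUr _ _) => JE.
    by move: iJ; rewrite -JE !inE eqxx.
  rewrite -existsNE => -[x]; rewrite not_implyE => -[xS]; rewrite not_implyE.
  move=> [/spanP[a xE] /eqP x0]; rewrite big_setU1 //= in xE.
  set t := \sum_(j in J) _ in xE.
  have tJ : t \in span J by apply/spanP; exists a.
  have av0 : a i *: v i != 0.
    apply: contra x0 => /eqP av0; apply/eqP/Jfree => //.
    by rewrite xE av0 add0r.
  have [b bE] := v_simple av0.
  exists (b *: x, - (b *: t)); split=> /=; first exact: SZ.
    by rewrite -scaleN1r; apply: (TZ); apply: (TZ).
  by rewrite xE scalerDr bE addrK.
have /choice[st stP] := sumv.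
move=> x; have [a ->] := v_gen x.
exists (\sum_i a i *: (st i).1), (\sum_i a i *: (st i).2); split.
- elim/big_rec: _ => // i y _ yS; apply: SD => //; apply: SZ.
  by case: (stP i).
- elim/big_rec: _ => // i y _ yS; apply: TD => //; apply: TZ.
  by case: (stP i).
rewrite -big_split /=; apply: eq_bigr => i _; rewrite -scalerDr.
by case: (stP i) => _ _ <-.
Qed.

End Semisimplicity.

Section FiniteDimensional.

Variables (k : closedFieldType) (A : algType k).
Implicit Types (h e a : A) (p q : {poly k}).

Lemma horner_algMXaddC h p (c : k) :
  horner_alg h (p * 'X + c%:P) = horner_alg h p * h + c%:A.
Proof. by rewrite rmorphD rmorphM /= horner_algX horner_algC. Qed.

Lemma horner_algXsubC h (c : k) : horner_alg h ('X - c%:P) = h - c%:A.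
Proof. by rewrite rmorphB /= horner_algX horner_algC. Qed.

Lemma horner_algXaddC h (c : k) : horner_alg h ('X + c%:P) = h + c%:A.
Proof. by rewrite rmorphD /= horner_algX horner_algC. Qed.

Lemma horner_alg_shift h e (c : k) p : h * e = e * (h + c%:A) ->
  horner_alg h p * e = e * horner_alg h (p \Po ('X + c%:P)).
Proof.
move=> he; elim/poly_ind: p => [|p d IH].
  by rewrite comp_poly0 !rmorph0 mul0r mulr0.
rewrite comp_poly_MXaddC horner_algMXaddC mulrDl -mulrA he mulrA IH.
rewrite [horner_alg h (_ + _)]rmorphD rmorphM /= horner_algXaddC horner_algC.
by rewrite [RHS]mulrDr mulrA mulr_algl mulr_algr.
Qed.

Lemma horner_alg_comm h e p : h * e = e * h ->
  horner_alg h p * e = e * horner_alg h p.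
Proof.
move=> he; rewrite (@horner_alg_shift h e 0) ?scale0r ?addr0 //.
by rewrite comp_polyXr.
Qed.

Lemma horner_alg_comm2 h e p q : h * e = e * h ->
  horner_alg h p * horner_alg e q = horner_alg e q * horner_alg h p.
Proof. by move=> he; apply: horner_alg_comm; symmetry; apply: horner_alg_comm. Qed.

Variable M : lmodType A.
Implicit Types x v : M.

Lemma scalarC (c : k) a x : c%:A *: (a *: x) = a *: (c%:A *: x).
Proof. by rewrite !scalerA mulr_algl mulr_algr. Qed.

Lemma horner_alg_eigen h v (c : k) p : h *: v = c%:A *: v ->
  horner_alg h p *: v = (p.[c])%:A *: v.
Proof.
move=> hv; elim/poly_ind: p => [|p d IH].
  by rewrite rmorph0 horner0 !scale0r.
rewrite horner_algMXaddC hornerMXaddC scalerDl -scalerA hv -scalarC IH.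
rewrite scalerA -scalerDl; congr (_ *: _).
by rewrite scalerDl mulr_algl scalerA mulrC.
Qed.

Hypothesis Mfd : finite_dimensional M.

Lemma vector_annihilator h x : exists2 p, p != 0 & horner_alg h p *: x = 0.
Proof.
have [s sP] := Mfd; set d := size s.
have /choice[c cP] (e : nat) : exists c : 'I_d -> k,
  h ^+ e *: x = \sum_i (c i)%:A *: s`_i by exact: sP.
pose B : 'M[k]_(d.+1, d) := \matrix_(e, j) c e j.
have kB : kermx B != 0.
  rewrite kermx_eq0 /row_free; apply/eqP => rB.
  by have := rank_leq_col B; rewrite rB ltnn.
pose u := nz_row (kermx B).
have u0 : u != 0 by rewrite nz_row_eq0.
have uB : u *m B = 0 by apply/sub_kermxP; exact: nz_row_sub.
exists (rVpoly u).
  by apply: contra u0 => /eqP up; rewrite -[u]rVpolyK up raddf0.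
have -> : rVpoly u = \sum_(e < d.+1) u 0 e *: 'X^e.
  by rewrite /rVpoly poly_def; apply: eq_bigr => e _; rewrite valK.
rewrite raddf_sum scaler_suml /=.
transitivity (\sum_(j < d) (\sum_(e < d.+1) u 0 e * c e j)%:A *: s`_j).
  transitivity (\sum_(e < d.+1) \sum_(j < d) (u 0 e * c e j)%:A *: s`_j).
    apply: eq_bigr => e _; rewrite linearZ rmorphXn /= horner_algX.
    rewrite -mulr_algl -scalerA cP scaler_sumr; apply: eq_bigr => j _.
    by rewrite mulr1 scalerA mulr_algl scalerA.
  rewrite exchange_big; apply: eq_bigr => j _.
  by rewrite -scaler_suml -scaler_suml.
apply: big1 => j _; suff -> : \sum_(e < d.+1) u 0 e * c e j = 0 by rewrite !scale0r.
transitivity ((u *m B) 0 j); last by rewrite uB mxE.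
by rewrite mxE; apply: eq_bigr => e _; rewrite mxE.
Qed.

Lemma annihilator h : exists2 p, p != 0 & forall x, horner_alg h p *: x = 0.
Proof.
have [s sP] := Mfd.
have /choice[p pP] (i : 'I_(size s)) : exists p, p != 0 /\ horner_alg h p *: s`_i = 0.
  by have [p ? ?] := vector_annihilator h s`_i; exists p.
exists (\prod_i p i); first by apply/prodf_neq0 => i _; case: (pP i).
move=> x; have [c ->] := sP x; rewrite scaler_sumr big1 // => i _.
rewrite -scalarC (bigD1 i) //= mulrC rmorphM /= -scalerA.
by case: (pP i) => _ ->; rewrite !scaler0.
Qed.

Hypothesis char0 : [pchar k] =i pred0.

Lemma natr_notin (s : seq k) : exists N, N%:R \notin s.
Proof.
apply: contrapT => /forallNP h.
have /uniq_leq_size : uniq [seq d%:R : k | d <- iota 0 (size s).+1].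
  rewrite map_inj_uniq ?iota_uniq // => d e /eqP.
  have nat0 b : (b%:R == 0 :> k) = (b == 0)%N by move/pcharf0P: char0 => ->.
  wlog de : d e / (d <= e)%N.
    move=> hw; case/orP: (leq_total d e) => ? /eqP E.
      by apply: hw; rewrite ?E.
    by symmetry; apply: hw; rewrite ?E.
  rewrite eq_sym -subr_eq0 -natrB // nat0 subn_eq0 => ed.
  by apply/eqP; rewrite eqn_leq de ed.
move=> /(_ s); rewrite size_map size_iota ltnn => sub.
suff : false by [].
by apply: sub => x /mapP[d _ ->]; apply: contrapT => /negP/(h d).
Qed.

(* [e] shifts the eigenvalues of [h] by 1, and they are finitely many. *)
Lemma shift_nilpotent h e : h * e = e * (h + 1) ->
  exists N, forall N' x, (N <= N')%N -> e ^+ N' *: x = 0.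
Proof.
move=> he; have [p p0 pM] := annihilator h.
have [rs prs] := closed_field_poly_normal p.
have rsE z : root p z = (z \in rs).
  by rewrite prs rootZ ?lead_coef_eq0 // root_prod_XsubC.
have [N Nrs] := natr_notin [seq r' - r | r <- rs, r' <- rs].
have hN d : h * e ^+ d = e ^+ d * (h + d%:R%:A).
  elim: d => [|d IH]; first by rewrite mulr0n scale0r addr0 mul1r mulr1.
  rewrite exprSr mulrA IH -!mulrA; congr (_ * _).
  rewrite mulrDl he mulr_algl -mulr_algr -mulrDr; congr (_ * _).
  by rewrite -natr1 scalerDl scale1r addrA addrAC.
have cop : coprimep p (p \Po ('X + N%:R%:P)).
  apply: Pdiv.ClosedField.root_coprimep => z; rewrite rsE => zrs.
  rewrite horner_comp !hornerE; apply: contra Nrs => zN.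
  have : z + N%:R \in rs by rewrite -rsE.
  by move=> zNrs; apply/allpairsP; exists (z, z + N%:R); split=> //=; rewrite addrAC subrr add0r.
exists N => N' x /subnK <-; rewrite exprD -scalerA.
suff -> : e ^+ N *: x = 0 by rewrite scaler0.
have /Bezout_eq1_coprimepP[[u v] /= uv1] := cop.
rewrite -[x]scale1r -(rmorph1 (horner_alg h)) -uv1 rmorphD !rmorphM /= scalerDl.
rewrite -[(_ u * _) *: x]scalerA pM scaler0 add0r.
rewrite (horner_alg_comm2 v (p \Po ('X + N%:R%:P)) (erefl (h * h))).
by rewrite scalerA mulrA -(horner_alg_shift p (hN N)) -!scalerA pM.
Qed.

End FiniteDimensional.

Section Interpolation.

Variable k : fieldType.
Hypothesis char0 : [pchar k] =i pred0.

Lemma intr_eq0_char0 (z : int) : (z%:~R == 0 :> k) = (z == 0).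
Proof.
have nat0 b : (b%:R == 0 :> k) = (b == 0)%N by move/pcharf0P: char0 => ->.
by case: z => b; rewrite ?NegzE ?mulrNz ?oppr_eq0 -pmulrn nat0.
Qed.

Lemma intr_inj_char0 : injective (fun z : int => z%:~R : k).
Proof.
by move=> x y /eqP; rewrite -subr_eq0 -rmorphB /= intr_eq0_char0 subr_eq0 => /eqP.
Qed.

Definition node (N : nat) (s : 'I_(N + N)) : int := (s : nat)%:Z - N%:Z.

Definition falling_poly (N : nat) : {poly k} := \prod_(s < N) ('X - s%:R%:P).
Definition rising_poly (N : nat) : {poly k} := \prod_(s < N) ('X + s.+1%:R%:P).
Definition node_poly (N : nat) : {poly k} :=
  \prod_(s < N + N) ('X - ((node s)%:~R)%:P).

Definition lagrange_poly (N : nat) (s : 'I_(N + N)) : {poly k} :=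
  \prod_(t < N + N | t != s)
    (((node s - node t)%:~R)^-1 *: ('X - ((node t)%:~R)%:P)).

Lemma node_inj N : injective (@node N).
Proof. by move=> s t /addIr []; exact: val_inj. Qed.

Lemma nodeP N (z : int) : - N%:Z <= z -> z < N%:Z -> exists s, z = @node N s.
Proof.
move=> z1 z2; have h : (absz (z + N%:Z)%R < N + N)%N by lia.
by exists (Ordinal h); rewrite /node /=; lia.
Qed.

Lemma node_polyE N : node_poly N = falling_poly N * rising_poly N.
Proof.
rewrite /node_poly big_split_ord /= mulrC; congr (_ * _).
  apply: eq_bigr => s _; rewrite /node /=.
  by rewrite PoszD addrAC subrr add0r.
rewrite (reindex_inj rev_ord_inj) /=; apply: eq_bigr => s _.
rewrite /node /=; have -> : (N - s.+1)%N%:Z - N%:Z = - s.+1%:Z.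
  by have := ltn_ord s; lia.
by rewrite mulrNz polyCN opprK.
Qed.

Lemma falling_poly_eval N (z : int) : (falling_poly N).[z%:~R] = 0 -> 0 <= z < N%:Z.
Proof.
move=> /eqP; rewrite horner_prod => /prodf_eq0[s _].
rewrite !hornerE -[(nat_of_ord s)%:R]/((s : nat)%:Z%:~R : k) -rmorphB intr_eq0_char0.
by have := ltn_ord s; lia.
Qed.

Lemma rising_poly_eval N (z : int) : (rising_poly N).[z%:~R] = 0 -> - N%:Z <= z < 0.
Proof.
move=> /eqP; rewrite horner_prod => /prodf_eq0[s _].
rewrite !hornerE -[s.+1%:R]/(s.+1%:Z%:~R : k) -rmorphD intr_eq0_char0.
by have := ltn_ord s; lia.
Qed.

Lemma falling_rising_coprime N : coprimep (falling_poly N) (rising_poly N).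
Proof.
rewrite /falling_poly; elim/big_rec: _ => [|s p _ IH]; first exact: coprime1p.
rewrite coprimepMl IH andbT coprimep_sym coprimep_XsubC.
apply/negP => /eqP; rewrite -[(nat_of_ord s)%:R]/((s : nat)%:Z%:~R : k).
by move/rising_poly_eval; lia.
Qed.

Lemma node_poly_eval N (z : int) : (node_poly N).[z%:~R] = 0 ->
  exists s, z = @node N s.
Proof.
rewrite node_polyE hornerM => /eqP; rewrite mulf_eq0.
by case/orP => /eqP; [move/falling_poly_eval|move/rising_poly_eval] => h; apply: nodeP; lia.
Qed.

Lemma lagrange_poly_eval N (s t : 'I_(N + N)) :
  (lagrange_poly s).[(node t)%:~R] = (s == t)%:R.
Proof.
rewrite /lagrange_poly horner_prod; have [<-|st] := eqVneq s t.
  apply: big1 => u us; rewrite !hornerE -rmorphB mulVf // intr_eq0_char0 subr_eq0.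
  by rewrite (inj_eq (@node_inj N)) eq_sym.
by rewrite (bigD1 t) 1?eq_sym //= !hornerE subrr mulr0 mul0r.
Qed.

Lemma lagrange_poly_node N (s : 'I_(N + N)) : exists c : k,
  ('X - ((node s)%:~R)%:P) * lagrange_poly s = c *: node_poly N.
Proof.
exists (\prod_(t < N + N | t != s) ((node s - node t)%:~R)^-1).
rewrite /lagrange_poly scaler_prod -scalerAr /node_poly; congr (_ *: _).
by rewrite [RHS](bigD1 s).
Qed.

Lemma sum_lagrange_poly N : (0 < N)%N -> \sum_(s < N + N) lagrange_poly s = 1.
Proof.
move=> N0; apply/eqP; rewrite -subr_eq0; set D := _ - 1.
have szD : (size D <= N + N)%N.
  apply: (leq_trans (size_polyD _ _)); rewrite size_polyN size_poly1 geq_max.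
  rewrite (leq_trans N0) ?leq_addr // andbT.
  apply: (leq_trans (size_sum _ _ _)); apply/bigmax_leqP => s _.
  rewrite /lagrange_poly scaler_prod; apply: (leq_trans (size_scale_leq _ _)).
  rewrite -big_filter size_prod_XsubC -sum1_size big_filter sum1_card.
  by rewrite (cardC1 s) card_ord; lia.
apply: contraT => D0.
have := max_poly_roots D0 (rs := [seq (node t)%:~R | t <- enum 'I_(N + N)]).
rewrite size_map size_enum_ord ltnNge szD; apply.
  apply/allP => _ /mapP[t _ ->]; rewrite rootE /D hornerD hornerN hornerC horner_sum.
  rewrite (bigD1 t) //= lagrange_poly_eval eqxx big1 ?addr0 ?subrr // => s st.
  by rewrite lagrange_poly_eval (negPf st).
by rewrite map_inj_uniq ?enum_uniq // => s t /intr_inj_char0/node_inj.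
Qed.

End Interpolation.

Section WeightModules.

Variables (k : closedFieldType) (A : algType k) (n : nat) (cls : 'I_n -> bool).
Variable E : 'I_n -> 'I_n -> A.
Local Notation H i := (E i i).
Implicit Types (w lam nu : 'I_n -> int).

Definition homogeneous w (b : A) :=
  forall l, H l * b = b * (H l + ((w l)%:~R : k)%:A).

Hypothesis char0 : [pchar k] =i pred0.
Hypothesis E_homogeneous : forall i j, cls i = cls j ->
  homogeneous (fun l => (l == i)%:Z - (l == j)%:Z) (E i j).
Hypothesis EE : forall i j, i != j -> cls i = cls j ->
  E j i * E i j = H j * (H i + 1).
Hypothesis cls_nontrivial : forall i, exists2 j, i != j & cls i = cls j.
Hypothesis homogeneous_span : forall a : A,
  exists (K : nat) (b : 'I_K -> A) (w : 'I_K -> 'I_n -> int),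
    a = \sum_i b i /\ forall i,
    [/\ homogeneous (w i) (b i),
        forall c, \sum_(l | cls l == c) w i l = 0
      & (forall l, w i l = 0) -> exists (c : k) (p : 'I_n -> {poly k}),
          b i = c *: \prod_l horner_alg (H l) (p l)].

Lemma homogeneousM w w' a b : homogeneous w a -> homogeneous w' b ->
  homogeneous (fun l => w l + w' l) (a * b).
Proof.
move=> ha hb l; rewrite mulrA ha -!mulrA; congr (_ * _).
rewrite mulrDl hb mulr_algl -[_ *: b]mulr_algr -mulrDr; congr (_ * _).
by rewrite -addrA -scalerDl rmorphD /= [_%:~R + _]addrC.
Qed.

Lemma homogeneousX w a N : homogeneous w a ->
  homogeneous (fun l => w l *+ N) (a ^+ N).
Proof.
move=> ha; elim: N => [|N IH] l; first by rewrite mulr0n scale0r addr0 mul1r mulr1.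
by rewrite exprS (homogeneousM ha IH) mulrS.
Qed.

Lemma HC i j : H i * H j = H j * H i.
Proof. by rewrite (E_homogeneous (erefl (cls j))) subrr scale0r addr0. Qed.

Lemma EE_pow i j N : i != j -> cls i = cls j -> E j i ^+ N * E i j ^+ N =
  horner_alg (H j) (falling_poly k N) * horner_alg (H i) (rising_poly k N).
Proof.
move=> ij cij; elim: N => [|N IH].
  by rewrite /falling_poly /rising_poly !big_ord0 !rmorph1 mulr1.
rewrite exprSr exprS mulrA -(mulrA _ (E j i)) EE //.
have hX := homogeneousX N (E_homogeneous cij).
have hi : E i j ^+ N * (H i + N%:R%:A) = H i * E i j ^+ N.
  by rewrite (hX i) eqxx (negPf ij) subr0 rmorphMn.
have hj : E i j ^+ N * (H j - N%:R%:A) = H j * E i j ^+ N.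
  rewrite (hX j) eqxx eq_sym (negPf ij) sub0r rmorphMn /= rmorphN /= mulNrn.
  by rewrite scaleNr.
have -> : E j i ^+ N * (H j * (H i + 1)) * E i j ^+ N =
    E j i ^+ N * E i j ^+ N * ((H j - N%:R%:A) * (H i + N.+1%:R%:A)).
  rewrite -!mulrA; congr (_ * _); rewrite [RHS]mulrA hj -mulrA; congr (_ * _).
  by rewrite mulrDl mul1r -hi -natr1 scalerDl scale1r addrA [RHS]mulrDr mulr1.
have fS : horner_alg (H j) (falling_poly k N.+1) =
    horner_alg (H j) (falling_poly k N) * (H j - N%:R%:A).
  by rewrite /falling_poly big_ord_recr rmorphM /= horner_algXsubC.
have rS : horner_alg (H i) (rising_poly k N.+1) =
    horner_alg (H i) (rising_poly k N) * (H i + N.+1%:R%:A).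
  by rewrite /rising_poly big_ord_recr rmorphM /= horner_algXaddC.
have HjX : H j - N%:R%:A = horner_alg (H j) ('X - N%:R%:P).
  by rewrite horner_algXsubC.
rewrite IH fS rS -!mulrA; congr (_ * _); rewrite !mulrA HjX; congr (_ * _).
exact/horner_alg_comm2/HC.
Qed.

Variable M : lmodType A.
Hypothesis Mfd : finite_dimensional M.
Implicit Types x y v : M.

Definition weight lam v := forall l, H l *: v = ((lam l)%:~R : k)%:A *: v.

Lemma weight_homogeneous w lam b v : homogeneous w b -> weight lam v ->
  weight (fun l => lam l + w l) (b *: v).
Proof.
move=> hb hv l; rewrite scalerA hb -scalerA scalerDl hv -scalerDl scalarC.
by rewrite -scalerDl -rmorphD.
Qed.

Lemma E_nilpotent : exists2 N, (0 < N)%N &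
  forall i j x, i != j -> cls i = cls j -> E i j ^+ N *: x = 0.
Proof.
have /choice[N NP] (ij : 'I_n * 'I_n) : exists N, forall N' x, (N <= N')%N ->
    ij.1 != ij.2 -> cls ij.1 = cls ij.2 -> E ij.1 ij.2 ^+ N' *: x = 0.
  have [cij|cij] := eqVneq (cls ij.1) (cls ij.2); last first.
    by exists 0%N => ? ? _ _ c; rewrite c eqxx in cij.
  have [ij0|ij0] := eqVneq ij.1 ij.2; first by exists 0%N.
  have [|N NP] := @shift_nilpotent k A M Mfd char0 (H ij.1) (E ij.1 ij.2).
    by rewrite (E_homogeneous cij) eqxx (negPf ij0) subr0 scale1r.
  by exists N => N' x NN' _ _; exact: NP.
exists (\max_ij N ij).+1 => // i j x ij cij; apply: (NP (i, j)) => //.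
by apply: leqW; exact: (leq_bigmax (i, j)).
Qed.

(* With h = H i, h' = H j, P and Q coprime: P(h) Q(h') = P(h') Q(h) = 0 gives
   P(h) Q(h) = 0. *)
Lemma H_split : exists2 N, (0 < N)%N &
  (forall i x, horner_alg (H i) (node_poly k N) *: x = 0) /\
  (forall i j x, i != j -> cls i = cls j ->
     horner_alg (H j) (falling_poly k N) *: (horner_alg (H i) (rising_poly k N) *: x) = 0).
Proof.
have [N N0 NP] := E_nilpotent; exists N => //.
have FR i j x : i != j -> cls i = cls j ->
     horner_alg (H j) (falling_poly k N) *: (horner_alg (H i) (rising_poly k N) *: x) = 0.
  by move=> ij cij; rewrite scalerA -EE_pow // -scalerA (NP i j) // scaler0.
split=> // i x; have [j ij cij] := cls_nontrivial i.
have /Bezout_eq1_coprimepP[[u v] /= uv1] := falling_rising_coprime char0 N.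
have HCp p q : horner_alg (H i) p * horner_alg (H j) q =
    horner_alg (H j) q * horner_alg (H i) p by exact/horner_alg_comm2/HC.
have FRi y : horner_alg (H i) (falling_poly k N) *:
    (horner_alg (H j) (rising_poly k N) *: y) = 0 by apply: FR; rewrite // eq_sym.
have FRj y : horner_alg (H i) (rising_poly k N) *:
    (horner_alg (H j) (falling_poly k N) *: y) = 0.
  by rewrite scalerA HCp -scalerA FR.
have -> : x = horner_alg (H j) (falling_poly k N) *: (horner_alg (H j) u *: x) +
    horner_alg (H j) (rising_poly k N) *: (horner_alg (H j) v *: x).
  rewrite !scalerA -scalerDl -!rmorphM -rmorphD /=.
  by rewrite [_ * u]mulrC [_ * v]mulrC uv1 rmorph1 scale1r.
rewrite node_polyE scalerDr {1}rmorphM /= -scalerA FRj scaler0 add0r.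
by rewrite mulrC rmorphM /= -scalerA FRi scaler0.
Qed.

Section Projectors.

Variable N : nat.
Hypothesis N_gt0 : (0 < N)%N.
Hypothesis node_ann : forall i x, horner_alg (H i) (node_poly k N) *: x = 0.
Hypothesis FR_ann : forall i j x, i != j -> cls i = cls j ->
  horner_alg (H j) (falling_poly k N) *: (horner_alg (H i) (rising_poly k N) *: x) = 0.

Local Notation index := {ffun 'I_n -> 'I_(N + N)}.
Implicit Type mu : index.

Definition index_weight mu : 'I_n -> int := fun l => node (mu l).
Definition projector mu : A := \prod_l horner_alg (H l) (lagrange_poly k (mu l)).

Lemma sum_projector : \sum_mu projector mu = 1.
Proof.
rewrite /projector -(bigA_distr_bigA
  (fun l s => horner_alg (H l) (@lagrange_poly k N s))) /=.
by apply: big1 => l _; rewrite -rmorph_sum /= sum_lagrange_poly // rmorph1.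
Qed.

Lemma projector_eigen mu (r : seq 'I_n) x l : l \in r ->
  H l *: (\prod_(j <- r) horner_alg (H j) (lagrange_poly k (mu j)) *: x) =
  ((node (mu l))%:~R : k)%:A *:
    (\prod_(j <- r) horner_alg (H j) (lagrange_poly k (mu j)) *: x).
Proof.
elim: r => // j r IH; rewrite big_cons inE -scalerA => /predU1P[->|/IH {}IH].
  set y := _ *: x; apply/eqP; rewrite -subr_eq0 -scalerBl.
  have -> : H j - ((node (mu j))%:~R : k)%:A =
      horner_alg (H j) ('X - ((node (mu j))%:~R)%:P).
    by rewrite horner_algXsubC.
  rewrite scalerA -rmorphM; have [c ->] := lagrange_poly_node k (mu j).
  by rewrite /= linearZ /= -mulr_algl -scalerA node_ann scaler0.
by rewrite (scalerA (H l)) -(horner_alg_comm _ (HC j l)) -scalerA IH [RHS]scalarC.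
Qed.

Lemma projector_weight mu x : weight (index_weight mu) (projector mu *: x).
Proof. by move=> l; apply: projector_eigen; rewrite mem_index_enum. Qed.

Lemma prod_eigen lam v (p : 'I_n -> {poly k}) : weight lam v ->
  (\prod_l horner_alg (H l) (p l)) *: v = (\prod_l (p l).[(lam l)%:~R])%:A *: v.
Proof.
move=> hv; elim: (index_enum _) => [|l r IH]; first by rewrite !big_nil !scale1r.
rewrite !big_cons -scalerA IH -scalarC (horner_alg_eigen (p l) (hv l)) scalerA.
by congr (_ *: _); rewrite mulr_algl scalerA mulrC.
Qed.

Lemma scalar_eq0 (c : k) v : c%:A *: v = 0 -> v != 0 -> c = 0.
Proof.
move=> cv v0; apply/eqP; apply: contraNT v0 => c0; apply/eqP.
rewrite -[v]scale1r -(rmorph1 (in_alg A)) -(mulVf c0).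
by rewrite rmorphM /= -scalerA cv scaler0.
Qed.

Lemma weight_index lam v : weight lam v -> v != 0 ->
  exists mu, lam =1 index_weight mu.
Proof.
move=> hv v0.
have /choice[mu muP] l : exists s, lam l = @node N s.
  apply: (node_poly_eval char0); move: (node_ann l v).
  by rewrite (horner_alg_eigen _ (hv l)) => /scalar_eq0; apply.
by exists (finfun mu) => l; rewrite /index_weight ffunE.
Qed.

Lemma projector_on lam v mu : weight lam v ->
  projector mu *: v != 0 -> lam =1 index_weight mu.
Proof.
move=> hv pv; have v0 : v != 0 by apply: contra pv => /eqP ->; rewrite scaler0.
have [nu nuE] := weight_index hv v0.
suff <- : nu = mu by [].
apply/ffunP => l; apply/eqP; move: pv; rewrite /projector (prod_eigen _ hv).
apply: contraNT => lm; rewrite (bigD1 l) //= nuE lagrange_poly_eval //.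
by rewrite [mu l == _]eq_sym (negPf lm) mul0r !scale0r.
Qed.

Lemma projector_id lam v mu : weight lam v -> lam =1 index_weight mu ->
  projector mu *: v = v.
Proof.
move=> hv lm; rewrite /projector (prod_eigen _ hv) big1 ?scale1r // => l _.
by rewrite lm lagrange_poly_eval ?eqxx.
Qed.

Lemma weight_sign lam v i j : weight lam v -> v != 0 -> cls i = cls j ->
  (0 <= lam i) = (0 <= lam j).
Proof.
move=> hv v0.
have h i' j' : i' != j' -> cls i' = cls j' -> (0 <= lam j') || (lam i' < 0).
  move=> ij cij; have := FR_ann v ij cij.
  rewrite (horner_alg_eigen _ (hv i')) -scalarC (horner_alg_eigen _ (hv j')).
  rewrite scalerA mulr_algl scalerA => /scalar_eq0/(_ v0)/eqP.
  rewrite mulf_eq0 => /orP[] /eqP; [move/(rising_poly_eval char0)|move/(falling_poly_eval char0)];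
  by move=> /andP[]; lia.
have [<- //|ij cij] := eqVneq i j.
have := h i j ij cij; have := h j i; rewrite eq_sym ij cij => /(_ isT erefl); lia.
Qed.

Lemma component lam v a mu : weight lam v -> projector mu *: (a *: v) != 0 ->
  forall c, \sum_(l | cls l == c) lam l = \sum_(l | cls l == c) index_weight mu l.
Proof.
move=> hv; have [K [b [w [-> bP]]]] := homogeneous_span a => nz c.
have [i _ iP] : exists2 i, true & projector mu *: (b i *: v) != 0.
  apply: contrapT => h; case/negP: nz; rewrite scaler_suml scaler_sumr big1 // => i _.
  by apply/eqP/negP => /negP ?; apply: h; exists i.
have [bi wi _] := bP i.
have lm := projector_on (weight_homogeneous bi hv) iP.
transitivity (\sum_(l | cls l == c) lam l + \sum_(l | cls l == c) w i l).
  by rewrite wi addr0.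
rewrite -big_split /=; apply: eq_bigr => l _; exact: lm.
Qed.

Lemma component_scalar lam v a mu : weight lam v -> lam =1 index_weight mu ->
  exists c : k, projector mu *: (a *: v) = c%:A *: v.
Proof.
move=> hv lm; have [K [b [w [-> bP]]]] := homogeneous_span a.
have /choice[c cP] i : exists c : k, projector mu *: (b i *: v) = c%:A *: v.
  have [z|nz] := eqVneq (projector mu *: (b i *: v)) 0.
    by exists 0; rewrite !scale0r.
  have [bi _ w0] := bP i.
  have lm' := projector_on (weight_homogeneous bi hv) nz.
  have [|c [p bE]] := w0.
    by move=> l; have := lm' l; rewrite lm; lia.
  pose q := \prod_l (p l).[(lam l)%:~R].
  have bv : b i *: v = (c * q)%:A *: v.
    by rewrite bE -(mulr_algl c) -(scalerA c%:A) (prod_eigen _ hv) scalerA mulr_algl scalerA.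
  by exists (c * q); rewrite bv -(scalarC (c * q)) (projector_id hv lm).
exists (\sum_i c i); rewrite !scaler_suml scaler_sumr; apply: eq_bigr => i _.
exact: cP.
Qed.

(* One step towards [lam] along E i j is injective: E j i E i j acts on weight
   [nu] by [nu j * (nu i + 1)]. *)
Lemma weight_transport nu lam y : weight nu y -> y != 0 ->
  (forall l, (0 <= nu l) = (0 <= lam l)) ->
  (forall c, \sum_(l | cls l == c) nu l = \sum_(l | cls l == c) lam l) ->
  exists2 b, b *: y != 0 & weight lam (b *: y).
Proof.
move: {2}(\sum_l absz (nu l - lam l))%N (leqnn (\sum_l absz (nu l - lam l))%N) => d.
elim: d nu y => [|d IH] nu y.
  rewrite leqn0 sum_nat_eq0 => /forallP h hy y0 _ _; exists 1; rewrite scale1r //.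
  move=> l; have /implyP/(_ isT) := h l; rewrite hy absz_eq0 subr_eq0 => /eqP -> //.
move=> le hy y0 sgn sums.
have [h|] := boolP [forall l, nu l == lam l].
  by exists 1; rewrite scale1r // => l; rewrite hy (eqP (forallP h l)).
rewrite negb_forall => /existsP[l0 nl0]; set c := cls l0.
have [j [cj jlt]] : exists j, cls j = c /\ lam j < nu j.
  apply: contrapT => nj.
  have lej l : cls l == c -> nu l <= lam l.
    by move=> /eqP cl; rewrite leNgt; apply/negP => ?; apply: nj; exists l.
  have := sums c; rewrite (bigD1 l0) //= [RHS](bigD1 l0) //= => e.
  have : \sum_(i | (cls i == c) && (i != l0)) nu i <=
      \sum_(i | (cls i == c) && (i != l0)) lam i.
    by apply: ler_sum => i /andP[/lej].
  move: e (lej l0 (eqxx _)) nl0; move: (\sum_(_ | _) _) (\sum_(_ | _) _) => S1 S2.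
  by lia.
have [i [ci ilt]] : exists i, cls i = c /\ nu i < lam i.
  apply: contrapT => nj.
  have lej l : cls l == c -> lam l <= nu l.
    by move=> /eqP cl; rewrite leNgt; apply/negP => ?; apply: nj; exists l.
  have := sums c; rewrite (bigD1 l0) //= [RHS](bigD1 l0) //= => e.
  have : \sum_(i | (cls i == c) && (i != l0)) lam i <=
      \sum_(i | (cls i == c) && (i != l0)) nu i.
    by apply: ler_sum => i /andP[/lej].
  move: e (lej l0 (eqxx _)) nl0; move: (\sum_(_ | _) _) (\sum_(_ | _) _) => S1 S2.
  by lia.
have ij : i != j by apply: contraTneq ilt => ->; lia.
have cij : cls i = cls j by rewrite ci cj.
pose nu' l := nu l + ((l == i)%:Z - (l == j)%:Z).
have hE := weight_homogeneous (E_homogeneous cij) hy.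
have nu'i : nu' i = nu i + 1 by rewrite /nu' eqxx (negPf ij).
have nu'j : nu' j = nu j - 1 by rewrite /nu' eqxx eq_sym (negPf ij).
have nu'l l : l != i -> l != j -> nu' l = nu l.
  by rewrite /nu' => /negPf -> /negPf ->; rewrite addr0.
have [||l|c'|b bn bw] := IH nu' (E i j *: y) _ hE.
- rewrite -ltnS; apply: leq_trans le; rewrite (bigD1 i) //= [X in (_ < X)%N](bigD1 i) //=.
  rewrite (bigD1 j) 1?eq_sym //= [X in (_ < _ + X)%N](bigD1 j) 1?eq_sym //=.
  rewrite nu'i nu'j (eq_bigr (fun l => absz (nu l - lam l))).
    by move: (\sum_(_ < n | _) _)%N => r; lia.
  by move=> l /andP[li lj]; rewrite nu'l.
- apply/eqP => z; have /(congr1 (fun a => a *: y)) := EE ij cij.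
  rewrite -!scalerA z scaler0 scalerDl hy scale1r.
  have -> : ((nu i)%:~R : k)%:A *: y + y = ((nu i + 1)%:~R : k)%:A *: y.
    by rewrite rmorphD /= !scalerDl !scale1r.
  rewrite -scalarC hy scalerA mulr_algl scalerA -rmorphM => /esym/scalar_eq0/(_ y0)/eqP.
  rewrite intr_eq0_char0 // mulf_eq0; have := sgn i; have := sgn j; lia.
- have [->|li] := eqVneq l i; first by have := sgn i; rewrite nu'i; lia.
  have [->|lj] := eqVneq l j; first by have := sgn j; rewrite nu'j; lia.
  by rewrite nu'l.
- rewrite -sums big_split /= sumrB; apply/eqP.
  rewrite -subr_eq0 addrAC subrr add0r; have [ic|ic] := eqVneq (cls i) c'.
    rewrite (bigD1 i) ?ic //= eqxx big1 => [|l /andP[_ /negPf -> //]].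
    rewrite (bigD1 j) -?cij ?ic //= eqxx big1 ?subrr // => l /andP[_ /negPf -> //].
  rewrite !big1 ?subrr // => l lc.
    by case: eqP => // lj; move: lc; rewrite lj -cij (negPf ic).
  by case: eqP => // li; move: lc; rewrite li (negPf ic).
by exists (b * E i j); rewrite -scalerA.
Qed.

Lemma class_sum_sign lam l : (forall j, cls j = cls l -> (0 <= lam j) = (0 <= lam l)) ->
  (0 <= \sum_(j | cls j == cls l) lam j) = (0 <= lam l).
Proof.
move=> h; have [l0|l0] := boolP (0 <= lam l).
  by apply: sumr_ge0 => j /eqP/h ->.
rewrite (bigD1 l) //=; apply/negbTE; rewrite -ltNge.
have : \sum_(j | (cls j == cls l) && (j != l)) lam j <= 0.
  apply: sumr_le0 => j /andP[/eqP/h jl _].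
  by rewrite ltW // ltNge jl.
by move: l0; rewrite -ltNge; move: (\sum_(_ | _) _) => S; lia.
Qed.

Lemma weight_simple lam v a : weight lam v -> a *: v != 0 ->
  exists b, b *: (a *: v) = v.
Proof.
move=> hv av0; have v0 : v != 0 by apply: contra av0 => /eqP ->; rewrite scaler0.
have [mu muP] : exists mu, projector mu *: (a *: v) != 0.
  apply: contrapT => h; case/negP: av0.
  rewrite -[a *: v]scale1r -sum_projector scaler_suml big1 // => mu _.
  by apply/eqP/negP => /negP ?; apply: h; exists mu.
have hy := projector_weight mu (a *: v).
have sums := component hv muP.
have [l|c|b bn bw] := weight_transport hy muP (lam := lam).
- have sgn lam' v' : weight lam' v' -> v' != 0 ->
      (0 <= \sum_(j | cls j == cls l) lam' j) = (0 <= lam' l).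
    by move=> hv' v'0; apply: class_sum_sign => j; exact: weight_sign.
  by rewrite -(sgn _ _ hy muP) -(sgn _ _ hv v0) sums.
- by rewrite sums.
have [mu' lm] := weight_index hv v0.
have bE : b *: (projector mu *: (a *: v)) = (b * projector mu * a) *: v.
  by rewrite !scalerA.
have := projector_id bw lm; rewrite {1}bE.
have [c ->] := component_scalar (b * projector mu * a) hv lm => cE.
have c0 : c != 0 by apply: contra bn => /eqP c0; rewrite -cE c0 !scale0r.
exists ((c^-1)%:A * (b * projector mu)).
by rewrite -!scalerA -cE scalerA mulr_algl scalerA mulVf // !scale1r.
Qed.

End Projectors.

Lemma finite_dimensional_completely_reducible : completely_reducible M.
Proof.
have [N N0 [node_ann FR_ann]] := H_split.
have [s sP] := Mfd.
pose J : finType := ('I_(size s) * {ffun 'I_n -> 'I_(N + N)})%type.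
pose v (j : J) : M := projector j.2 *: s`_j.1.
apply: (@generated_by_simple_completely_reducible A M J v).
  move=> x; have [c ->] := sP x; exists (fun j => (c j.1)%:A).
  rewrite -(pair_bigA _ (fun i mu => (c i)%:A *: (projector mu *: s`_i))) /=.
  by apply: eq_bigr => i _; rewrite -scaler_sumr -scaler_suml sum_projector // scale1r.
move=> j a.
exact: (weight_simple N0 node_ann FR_ann (projector_weight node_ann _ _)).
Qed.

End WeightModules.

(** * The FCR property *)

Section MonomialOperators.

Variables (k : closedFieldType) (n : nat).
Hypothesis char0 : [pchar k] =i pred0.

Local Notation pol := (mpoly n k).
Local Notation mon := (multinom (n + n)).
Local Notation A := (weyl_invariants k (alternating_mx n)).
Implicit Types (a b : A) (m : mon) (g : multinom n) (i j l : 'I_n).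

Definition monop m : A := insubd 0 (xdop k m).

Lemma val_monop m : balanced m -> invariant_val (monop m) = xdop k m.
Proof.
move=> bm; rewrite /monop -[LHS]/(eqtype.val _) insubdK //.
have /(invariantP char0) : forall m', m' \in msupp (mpolyX k m) -> balanced m'.
  by move=> m'; rewrite msuppX inE => /eqP ->.
by rewrite OpX.
Qed.

Lemma symb_monop m : balanced m -> symb (monop m) = mpolyX k m.
Proof. by move=> bm; apply: symbP => //; rewrite OpX val_monop. Qed.

Lemma monop_span a :
  a = \sum_(m <- msupp (symb a)) (symb a)@_m *: monop m.
Proof.
apply: (symb_inj (k := k) (n := n)); rewrite symb_sum // [LHS]mpolyE !big_seq.
apply: eq_bigr => m ma; rewrite symbZ // symb_monop //.
exact: symb_balanced ma.
Qed.

Lemma inv_ext a b :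
  (forall g, invariant_val a (mpolyX k g) = invariant_val b (mpolyX k g)) -> a = b.
Proof. by move=> ab; apply/val_inj/weyl_ext. Qed.

Lemma balanced_matrix_unit (i j : 'I_n) : odd i = odd j ->
  balanced (xdpart (mnm1 i) (mnm1 j)).
Proof.
move=> ij; apply/forallP => c; apply/eqP.
under eq_bigr do rewrite xdpart_l mnm1E.
under [RHS]eq_bigr do rewrite xdpart_r mnm1E.
have h (l : 'I_n) : (\sum_(i0 < n | odd i0 == c) (l == i0) = (odd l == c))%N.
  case: eqVneq => lc.
    rewrite (bigD1 l) ?lc //= eqxx big1 // => l' /andP[_]; rewrite eq_sym.
    by move=> /negPf ->.
  apply: big1 => l' l'c; case: eqP => // ll'; move: l'c; rewrite -ll'.
  by rewrite (negPf lc).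
by rewrite !h ij.
Qed.

Definition unitop (i j : 'I_n) : A := monop (xdpart (mnm1 i) (mnm1 j)).

Lemma unitopX i j g : odd i = odd j -> invariant_val (unitop i j) (mpolyX k g) =
  (g j)%:R *: mpolyX k (mnm1 i +m (g -m mnm1 j)).
Proof.
move=> ij; rewrite val_monop; last exact: balanced_matrix_unit.
rewrite xdopX xpart_xd dpart_xd (bigD1 j) //= mnm1E eqxx ffactn1 big1 ?muln1 //.
by move=> l /negPf lj; rewrite mnm1E eq_sym lj ffactn0.
Qed.

Lemma unitop_diagX i g :
  invariant_val (unitop i i) (mpolyX k g) = (g i)%:R *: mpolyX k g.
Proof.
rewrite unitopX //; have [->|gi] := eqVneq (g i) 0%N; first by rewrite !scale0r.
by rewrite addmC submK // lep1mP.
Qed.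

Lemma invME a b p : invariant_val (a * b) p = invariant_val a (invariant_val b p).
Proof. by []. Qed.
Lemma invDE a b p : invariant_val (a + b) p = invariant_val a p + invariant_val b p.
Proof. by []. Qed.
Lemma invZE (c : k) a p : invariant_val (c *: a) p = c *: invariant_val a p.
Proof. by []. Qed.
Lemma inv1E p : invariant_val (1 : A) p = p.
Proof. by []. Qed.

Lemma monop_homogeneous m : balanced m ->
  homogeneous unitop (fun l => (xpart m l)%:Z - (dpart m l)%:Z) (monop m).
Proof.
move=> bm l; apply: inv_ext => g.
rewrite !invME invDE invZE inv1E unitop_diagX -scalerDl weylZr val_monop //.
rewrite xdopX weylZr unitop_diagX !scalerA.
have [|] := boolP (dpart m <=m g); last first.
  move=> /mnm_lepP; rewrite -existsNE => -[i /negP]; rewrite -ltnNge => lt.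
  by rewrite (bigD1 i) //= ffact_small // mul0n mul0r mulr0 !scale0r.
move=> /mnm_lepP le; congr (_ *: _); rewrite mulrC; congr (_ * _).
rewrite mnmDE mnmBE rmorphB /= -!pmulrn natrD natrB ?le //.
by ring.
Qed.

Lemma unitop_homogeneous i j : odd i = odd j ->
  homogeneous unitop (fun l => (l == i)%:Z - (l == j)%:Z) (unitop i j).
Proof.
move=> ij l; rewrite (monop_homogeneous (balanced_matrix_unit ij) l).
by rewrite xpart_xd dpart_xd !mnm1E ![_ == l]eq_sym.
Qed.

Lemma unitop_mul i j : i != j -> odd i = odd j ->
  unitop j i * unitop i j = unitop j j * (unitop i i + 1).
Proof.
move=> ij oij; apply: inv_ext => g; rewrite !invME invDE inv1E.
rewrite unitop_diagX (unitopX g oij) -{2}[mpolyX k g]scale1r -scalerDl !weylZr.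
rewrite unitop_diagX unitopX // !scalerA.
have [->|gj] := eqVneq (g j) 0%N; first by rewrite mul0r mulr0 !scale0r.
rewrite mulrC mnmDE mnmBE !mnm1E eqxx eq_sym (negPf ij) subn0 natrD addrC.
congr (_ *: mpolyX _ _); apply/mnmP => l; rewrite !(mnmDE, mnmBE, mnm1E).
by have := gj; case: (j =P l) => [<-|_]; case: (i =P l) => //=; lia.
Qed.

Lemma horner_unitop i p g : invariant_val (horner_alg (unitop i i) p) (mpolyX k g) =
  p.[(g i)%:R] *: mpolyX k g.
Proof.
elim/poly_ind: p => [|p c IH]; first by rewrite rmorph0 horner0 scale0r.
rewrite horner_algMXaddC hornerMXaddC invDE invME unitop_diagX weylZr IH.
by rewrite invZE inv1E scalerA -scalerDl mulrC.
Qed.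

Lemma falling_poly_nat N d : (falling_poly k N).[d%:R] = (d ^_ N)%:R.
Proof.
rewrite horner_prod ffact_prod natr_prod; have [Nd|dN] := leqP N d.
  apply: eq_bigr => s _; rewrite !hornerE natrB //.
  by have := ltn_ord s; lia.
by rewrite (bigD1 (Ordinal dN)) // [RHS](bigD1 (Ordinal dN)) //= !hornerE subrr subnn !mul0r.
Qed.

Lemma monop_diag m : balanced m -> (forall l, (xpart m l)%:Z - (dpart m l)%:Z = 0) ->
  monop m = \prod_l horner_alg (unitop l l) (falling_poly k (dpart m l)).
Proof.
move=> bm xd; apply: inv_ext => g; rewrite val_monop // xdopX.
have -> : invariant_val (\prod_l horner_alg (unitop l l) (falling_poly k (dpart m l)))
    (mpolyX k g) = \prod_l ((g l) ^_ (dpart m l))%:R *: mpolyX k g.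
  elim: (index_enum _) => [|l r IH]; first by rewrite !big_nil scale1r.
  by rewrite !big_cons invME IH weylZr horner_unitop scalerA falling_poly_nat mulrC.
rewrite natr_prod.
have [|] := boolP (dpart m <=m g); last first.
  move=> /mnm_lepP; rewrite -existsNE => -[i /negP]; rewrite -ltnNge => lt.
  by rewrite (bigD1 i) //= ffact_small // mul0r !scale0r.
move=> le; have -> : xpart m = dpart m by apply/mnmP => l; have := xd l; lia.
by rewrite addmC submK.
Qed.

Lemma odd_nontrivial : (4 <= n)%N ->
  forall i : 'I_n, exists2 j : 'I_n, i != j & odd i = odd j.
Proof.
move=> n4 i; have [i2|i2] := leqP 2 i.
  have h : (i - 2 < n)%N by have := ltn_ord i; lia.
  exists (Ordinal h); first by apply/eqP => /(congr1 (@nat_of_ord n)) /=; lia.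
  by rewrite /= oddB //= addbF.
have h : (i + 2 < n)%N by lia.
exists (Ordinal h); first by apply/eqP => /(congr1 (@nat_of_ord n)) /=; lia.
by rewrite /= oddD addbF.
Qed.

Lemma invariants_completely_reducible (M : lmodType A) : (4 <= n)%N ->
  finite_dimensional M -> completely_reducible M.
Proof.
move=> n4 Mfd; apply: (finite_dimensional_completely_reducible
  (cls := fun i : 'I_n => odd i) (E := unitop)) => //.
- exact: unitop_homogeneous.
- exact: unitop_mul.
- exact: odd_nontrivial.
move=> a; pose s := msupp (symb a); pose m_ (e : 'I_(size s)) := nth (@mnm0 _) s e.
exists (size s), (fun e => (symb a)@_(m_ e) *: monop (m_ e)),
  (fun e l => (xpart (m_ e) l)%:Z - (dpart (m_ e) l)%:Z); split.
  by rewrite {1}[a]monop_span (big_nth (@mnm0 _)) big_mkord.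
move=> e; have bm : balanced (m_ e).
  by apply: symb_balanced (mem_nth _ (ltn_ord e)).
split=> [l|c|w0].
- by rewrite -scalerAr (monop_homogeneous bm) -scalerAl.
- rewrite sumrB -!(big_morph _ PoszD (erefl 0%:Z)).
  under eq_bigr do rewrite xpartE.
  under [X in _ - X%:Z]eq_bigr do rewrite dpartE.
  by rewrite (eqP (forallP bm c)) subrr.
- by eexists; exists (fun l => falling_poly k (dpart (m_ e) l)); rewrite monop_diag.
Qed.

Lemma mdeg_balanced m : balanced m -> mdeg (xpart m) = mdeg (dpart m).
Proof.
move=> /forallP bm; rewrite !mdegE (bigID (fun i : 'I_n => odd i == true)) /=.
rewrite [RHS](bigID (fun i : 'I_n => odd i == true)) /=.
have h (f : mon -> multinom n) : (\sum_(i < n | odd i != true) f m i =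
    \sum_(i < n | odd i == false) f m i)%N by apply: eq_bigl => i; case: odd.
rewrite (h (@xpart n)) (h (@dpart n)).
by congr (_ + _)%N; under eq_bigr do rewrite xpartE;
  under [RHS]eq_bigr do rewrite dpartE; apply/eqP.
Qed.

Lemma invariant_msize a (p : pol) : (msize (invariant_val a p) <= msize p)%N.
Proof.
have hX g : (msize (invariant_val a (mpolyX k g)) <= (mdeg g).+1)%N.
  rewrite -symbK OpE; apply: (leq_trans (msize_sum _ _ _)).
  apply/bigmax_leqP_seq => m ma _; apply: (leq_trans (msizeZ_le _ _)).
  rewrite xdopX; have [|] := boolP (dpart m <=m g); last first.
    move=> /mnm_lepP; rewrite -existsNE => -[i /negP]; rewrite -ltnNge => lt.
    by rewrite (bigD1 i) //= ffact_small // mul0n scale0r mmeasure0.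
  move=> le; apply: (leq_trans (msizeZ_le _ _)); rewrite msizeX mdegD.
  rewrite (mdeg_balanced (symb_balanced char0 ma)) addnC -mdegD.
  by rewrite submK.
rewrite {1}[p]mpolyE weyl_sumr; apply: (leq_trans (msize_sum _ _ _)).
apply/bigmax_leqP_seq => g gp _; rewrite weylZr.
apply: (leq_trans (msizeZ_le _ _)); apply: (leq_trans (hX g)).
exact: msize_mdeg_lt.
Qed.

End MonomialOperators.

Section PolynomialModules.

Variables (k : closedFieldType) (n D : nat).
Hypothesis char0 : [pchar k] =i pred0.

Local Notation pol := (mpoly n k).
Local Notation A := (weyl_invariants k (alternating_mx n)).

Definition small : {pred pol} := fun p => (msize p <= D)%N.

Lemma smallE p : (p \in small) = (msize p <= D)%N.
Proof. by []. Qed.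

Fact small_zmod : zmod_closed small.
Proof.
split=> [|p q]; rewrite !smallE ?mmeasure0 // => pD qD.
by apply: (leq_trans (msizeD_le _ _)); rewrite msizeN geq_max pD.
Qed.

HB.instance Definition _ := GRing.isZmodClosed.Build pol small small_zmod.

Record small_poly : Type := SmallPoly { small_val :> pol; _ : small_val \in small }.

HB.instance Definition _ := [isSub for small_val].
HB.instance Definition _ := [Choice of small_poly by <:].
HB.instance Definition _ := [SubChoice_isSubZmodule of small_poly by <:].

Fact small_act_proof (a : A) (p : small_poly) : invariant_val a (small_val p) \in small.
Proof. by rewrite smallE (leq_trans (invariant_msize char0 a p)) //; case: p. Qed.

Definition small_act (a : A) (p : small_poly) : small_poly :=
  SmallPoly (small_act_proof a p).

Fact small_actA a b p : small_act a (small_act b p) = small_act (a * b) p.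
Proof. exact: val_inj. Qed.

Fact small_act1 : left_id 1 small_act.
Proof. by move=> p; apply: val_inj. Qed.

Fact small_actDr : right_distributive small_act +%R.
Proof.
move=> a p q; apply: val_inj.
by have := weyl_linear (invariant_val a) 1 (small_val p) (small_val q); rewrite !scale1r.
Qed.

Fact small_actDl p : {morph small_act^~ p : a b / a + b}.
Proof. by move=> a b; apply: val_inj. Qed.

Definition small_module : lmodType A :=
  HB.pack small_poly (GRing.Zmodule_isLmodule.Build A small_poly
    small_actA small_act1 small_actDr small_actDl).

Lemma small_val_sum (I : Type) (r : seq I) (F : I -> small_module) :
  small_val (\sum_(i <- r) F i) = \sum_(i <- r) small_val (F i).
Proof. exact: (big_morph small_val). Qed.

Lemma small_valZ (c : k) (p : small_module) :
  small_val ((c%:A : A) *: p) = c *: small_val p.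
Proof. by []. Qed.

Lemma small_module_fd : finite_dimensional small_module.
Proof.
have XD (g : bmultinom n D) : mpolyX k g \in small.
  by rewrite smallE msizeX; exact: bmdeg.
pose s := [seq (SmallPoly (XD g) : small_module) | g <- index_enum (bmultinom n D)].
exists s => p.
exists (fun i => (small_val p)@_(mlead (small_val s`_i))).
pose F (q : small_module) := ((small_val p)@_(mlead (small_val q)))%:A *: q.
rewrite -(big_mkord xpredT (fun i => F s`_i)) -(big_nth 0 xpredT F) big_map.
apply: val_inj => /=; rewrite small_val_sum [LHS](@mpolywE _ _ D).
  by apply: eq_bigr => g _; rewrite /F small_valZ /= mleadXm.
by case: (p).
Qed.

End PolynomialModules.

Section FCRInvariants.

Variables (k : closedFieldType) (n : nat).
Hypothesis char0 : [pchar k] =i pred0.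

Lemma FCR_invariants : (4 <= n)%N -> FCR (weyl_invariants k (alternating_mx n)).
Proof.
move=> n4; split; last first.
  by move=> M; exact: invariants_completely_reducible.
move=> a a0; apply: inv_ext => g.
have gD : mpolyX k g \in @small k n (mdeg g).+1 by rewrite smallE msizeX.
have := a0 _ (@small_module_fd k n (mdeg g).+1 char0) (SmallPoly gD).
by move/(congr1 (@small_val _ _ _)).
Qed.

End FCRInvariants.

(** * Growth *)

Section DimSpan.

Variables (k : fieldType) (V : lmodType k).

Lemma dim_span_le (F : finType) (phi : F -> V -> k) (s : seq V) :
    (forall f (I : {set 'I_(size s)}) (c : 'I_(size s) -> k),
       phi f (\sum_(i in I) c i *: s`_i) = \sum_(i in I) c i * phi f s`_i) ->
    (forall (I : {set 'I_(size s)}) (c : 'I_(size s) -> k),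
       (forall f, phi f (\sum_(i in I) c i *: s`_i) = 0) ->
       \sum_(i in I) c i *: s`_i = 0) ->
  (Defs.dim_span s <= #|F|)%N.
Proof.
move=> phi_lin phi_sep; apply/bigmax_leqP => I /asboolP Ifree.
rewrite leqNgt; apply/negP => lt.
pose B : 'M[k]_(#|I|, #|F|) := 
  \matrix_(e < #|I|, f < #|F|) phi (enum_val f) s`_(enum_val e : 'I_(size s)).
have kB : kermx B != 0.
  rewrite kermx_eq0 /row_free; apply/eqP => rB.
  by have := rank_leq_col B; rewrite rB leqNgt lt.
pose u := nz_row (kermx B).
have u0 : u != 0 by rewrite nz_row_eq0.
have uB : u *m B = 0 by apply/sub_kermxP; exact: nz_row_sub.
pose c (i : 'I_(size s)) := \sum_(e < #|I| | enum_val e == i) u 0 e.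
have cE e : c (enum_val e) = u 0 e.
  rewrite /c (bigD1 e) //= big1 ?addr0 // => e' /andP[/eqP/enum_val_inj ->].
  by rewrite eqxx.
have sum0 : \sum_(i in I) c i *: s`_i = 0.
  apply: phi_sep => f; rewrite phi_lin big_enum_val /=.
  transitivity ((u *m B) 0 (enum_rank f)); last by rewrite uB mxE.
  by rewrite mxE; apply: eq_bigr => e _; rewrite mxE cE enum_rankK.
case/negP: u0; apply/eqP/rowP => e; rewrite mxE -cE.
by apply: Ifree sum0 _ _; exact: enum_valP.
Qed.

Lemma leq_dim_span (s : seq V) (I : {set 'I_(size s)}) :
  (forall c : 'I_(size s) -> k,
     \sum_(i in I) c i *: s`_i = 0 -> forall i, i \in I -> c i = 0) ->
  (#|I| <= Defs.dim_span s)%N.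
Proof.
move=> h; rewrite /Defs.dim_span.
by apply: (leq_bigmax_cond (P := fun I : {set 'I_(size s)} => `[< _ >])); exact/asboolP.
Qed.

End DimSpan.

Section Growth.

Variables (k : closedFieldType) (n : nat).
Hypothesis char0 : [pchar k] =i pred0.
Hypothesis n_ge4 : (4 <= n)%N.

Local Notation mon := (multinom (n + n)).
Local Notation A := (weyl_invariants k (alternating_mx n)).

Lemma words_msize (s : seq A) d : (forall a, a \in s -> (msize (symb a) <= d.+1)%N) ->
  forall M w, w \in words s M -> (msize (symb w) <= (d * M).+1)%N.
Proof.
move=> sd; elim=> [|M IH] w /=.
  by rewrite inE => /eqP ->; rewrite symb1 // mmeasure1.
rewrite inE => /predU1P[->|/allpairsP[[a v] /= [/sd ha /IH hv ->]]].
  by rewrite symb1 // mmeasure1.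
have [->|a0] := eqVneq a 0; first by rewrite mul0r symb0 // mmeasure0.
have [->|v0] := eqVneq v 0; first by rewrite mulr0 symb0 // mmeasure0.
have [_ _ ->] := symbM_lead char0 a0 v0.
move: ha hv; move: (msize _) (msize _) => x y; rewrite mulnS; lia.
Qed.

Definition base (c : bool) : 'I_n :=
  if c then Ordinal (leq_trans (isT : (2 <= 4)%N) n_ge4)
  else Ordinal (leq_trans (isT : (1 <= 4)%N) n_ge4).

Lemma odd_base c : odd (base c) = c.
Proof. by case: c. Qed.

Definition free_index :=
  {x : 'I_(n + n) | (x != lshift n (base false)) && (x != lshift n (base true))}.

Definition FreeIndex (x : 'I_(n + n))
    (h : (x != lshift n (base false)) && (x != lshift n (base true))) : free_index :=
  exist _ x h.

Lemma card_free_index : #|{: free_index}| = (2 * n - 2)%N.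
Proof.
pose P (x : 'I_(n + n)) :=
  (x != lshift n (base false)) && (x != lshift n (base true)).
have := cardC P; rewrite card_ord (@eq_card _ [predC P]
  [set lshift n (base false); lshift n (base true)]%SET); last first.
  by move=> x; rewrite !inE negb_and !negbK.
rewrite cards2 (inj_eq (@lshift_inj _ _)) card_sig /= => h.
by apply/eqP; rewrite -(eqn_add2r 2) h; lia.
Qed.

Lemma free_indexP (i : 'I_n) : i = base (odd i) \/
  ((lshift n i != lshift n (base false)) && (lshift n i != lshift n (base true))).
Proof.
have [->|ib] := eqVneq i (base (odd i)); [left; by rewrite odd_base|right].
rewrite !(inj_eq (@lshift_inj _ _)); apply/andP; split; apply: contra ib => /eqP e;
by rewrite {2}e odd_base e.
Qed.

Lemma balanced_determined (m m' : mon) : balanced m -> balanced m' ->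
  (forall x : free_index, m (val x) = m' (val x)) -> m = m'.
Proof.
move=> /forallP bm /forallP bm' mm'.
have hr i : m (rshift n i) = m' (rshift n i).
  have h : (rshift n i != lshift n (base false)) && (rshift n i != lshift n (base true)).
    by rewrite !eq_rlshift.
  exact: (mm' (FreeIndex h)).
apply/mnmP => x; rewrite -(splitK x); case: fintype.split => i /=; last exact: hr.
have [->|h] := free_indexP i; last exact: (mm' (FreeIndex h)).
set c := odd i; have := eqP (bm c); rewrite (bigD1 (base c)) ?odd_base //= => e.
have := eqP (bm' c); rewrite (bigD1 (base c)) ?odd_base //= => e'.
apply/eqP; rewrite -(eqn_add2r (\sum_(j < n | (odd j == c) && (j != base c)) m (lshift n j))).
apply/eqP; rewrite e (eq_bigr (fun j => m' (rshift n j))) // -e'; congr (_ + _)%N.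
apply: eq_bigr => j /andP[/eqP jc jb]; have [jE|h] := free_indexP j.
  by rewrite {1}jE jc eqxx in jb.
by symmetry; exact: (mm' (FreeIndex h)).
Qed.

Lemma dim_words_upper (s : seq A) : exists d, forall M,
  (Defs.dim_span (words s M) <= (d * M).+1 ^ (2 * n - 2))%N.
Proof.
pose d := \max_(a <- s) msize (symb a).
have sd a : a \in s -> (msize (symb a) <= d.+1)%N.
  move=> aS; apply: leqW; apply: (@leq_bigmax_seq _ _ xpredT (fun a => msize (symb a))) => //.
exists d => M; set D := (d * M)%N.
pose F : finType := {ffun free_index -> 'I_D.+1}.
have -> : (D.+1 ^ (2 * n - 2))%N = #|F| by rewrite card_ffun card_ord card_free_index.
have /choice[ext extP] (f : F) : exists m : mon, forall m', balanced m' ->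
    (forall x, m' (val x) = f x) -> m = m'.
  have [[m [bm mf]]|h] := pselect (exists m : mon, balanced m /\ (forall x, m (val x) = f x)).
    exists m => m' bm' m'f; apply: balanced_determined => // x; by rewrite mf m'f.
  by exists (@mnm0 _) => m' bm' m'f; case: h; exists m'.
apply: (dim_span_le (phi := fun f v => (symb v)@_(ext f))).
  move=> f I c; rewrite symb_sum // mcoeff_sum; apply: eq_bigr => i _.
  by rewrite symbZ // mcoeffZ.
move=> I c h; set v := \sum_(i in I) _ in h *; apply/eqP; rewrite -symb_eq0 //.
apply/eqP/mpolyP => m; rewrite mcoeff0; apply/eqP; rewrite mcoeff_eq0; apply/negP => mv.
have bm := symb_balanced char0 mv.
have mD : (mdeg m < D.+1)%N.
  have : (msize (symb v) <= D.+1)%N.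
    rewrite /v symb_sum //; apply: (leq_trans (msize_sum _ _ _)).
    apply/bigmax_leqP_seq => i _ _; rewrite symbZ //; apply: (leq_trans (msizeZ_le _ _)).
    by apply: words_msize sd _ _ _; exact: mem_nth.
  by apply: leq_trans; exact: msize_mdeg_lt.
have mx x : (m x < D.+1)%N.
  by apply: leq_ltn_trans mD; rewrite mdegE (bigD1 x) //= leq_addr.
have mE := extP [ffun x => Ordinal (mx (val x))] m bm.
move: mv; rewrite -mE ?mcoeff_msupp ?h ?eqxx // => x; by rewrite ffunE.
Qed.

End Growth.

Section LowerGrowth.

Variables (k : closedFieldType) (n : nat).
Hypothesis char0 : [pchar k] =i pred0.
Hypothesis n_ge4 : (4 <= n)%N.

Local Notation mon := (multinom (n + n)).
Local Notation A := (weyl_invariants k (alternating_mx n)).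
Local Notation base := (base n_ge4).
Local Notation free_index := (free_index n_ge4).

Definition unitops : seq A := [seq unitop k i j | i <- enum 'I_n, j <- enum 'I_n].

Lemma monomial_word M (m : mon) : balanced m -> (mdeg (dpart m) <= M)%N ->
  exists2 w, w \in words unitops M & w != 0 /\ mlead (symb w) = m.
Proof.
have w1 N : (1 : A) \in words unitops N by case: N => [|N]; rewrite inE eqxx.
have one : (1 : A) != 0 /\ mlead (symb (1 : A)) = @mnm0 _.
  by rewrite oner_neq0 symb1 // mlead1.
have m0P (m' : mon) : balanced m' -> mdeg (dpart m') = 0%N -> m' = @mnm0 _.
  by move=> bm h; apply/eqP; rewrite -mdeg_eq0 mdeg_xd mdeg_balanced // h.
elim: M m => [|M IH] m bm dm.
  by exists 1; rewrite // (m0P m) //; apply/eqP; rewrite -leqn0.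
have [d0|d0] := eqVneq (mdeg (dpart m)) 0%N; first by exists 1; rewrite // (m0P m).
have [j jm] : exists j, m (rshift n j) != 0%N.
  apply: contrapT => h; case/eqP: d0; rewrite mdegE big1 // => j _.
  by rewrite dpartE; apply/eqP/negP => /negP ?; apply: h; exists j.
have [i oij im] : exists2 i : 'I_n, odd i = odd j & m (lshift n i) != 0%N.
  apply: contrapT => h; have := eqP (forallP bm (odd j)).
  rewrite [RHS](bigD1 j) //= big1; first by move: jm; case: (m (rshift n j)).
  by move=> i /eqP oi; apply/eqP/negP => /negP ?; apply: h; exists i.
pose e := xdpart (mnm1 i) (mnm1 j); have be : balanced e by exact: balanced_matrix_unit.
have em : e <=m m.
  apply/mnm_lepP => x; rewrite -(splitK x); case: fintype.split => y /=.
    by rewrite xdpart_l mnm1E; case: eqP => [<-|//]; rewrite lt0n.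
  by rewrite xdpart_r mnm1E; case: eqP => [<-|//]; rewrite lt0n.
have [||w wM [w0 wm]] := IH (m -m e).
- exact: balanced_sub.
- rewrite -ltnS; apply: leq_trans dm; rewrite -{2}(submK em) dpartD mdegD.
  by rewrite dpart_xd mdeg1 addn1.
have se : symb (unitop k i j) = mpolyX k e by exact: symb_monop.
have u0 : unitop k i j != 0 by rewrite -symb_eq0 // se -msize_poly_eq0 msizeX.
have [uw0 uwl _] := symbM_lead char0 u0 w0.
exists (unitop k i j * w).
  rewrite /= inE; apply/orP; right; apply/allpairsP; exists (unitop k i j, w).
  split=> //=; apply/allpairsP; exists (i, j); rewrite /= !mem_enum; split=> //.
by split=> //; rewrite uwl se mleadXm wm addmC submK.
Qed.

Section Exponents.

Variable t : nat.
Local Notation F := {ffun free_index -> 'I_t.+1}.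

Definition extend0 (f : F) (x : 'I_(n + n)) : nat :=
  if (insub x : option free_index) is Some y then f y else 0%N.

Lemma extend0_le f x : (extend0 f x <= t)%N.
Proof. by rewrite /extend0; case: insub => // y; rewrite -ltnS. Qed.

Lemma extend0_val f (y : free_index) : extend0 f (val y) = f y.
Proof. by rewrite /extend0 valK. Qed.

(* The exponents of the first variables of the two classes are determined by
   balance; the shift by [n * t] makes them nonnegative. *)
Definition dexp (f : F) (j : 'I_n) : nat :=
  extend0 f (rshift n j) + (j == base (odd j)) * (n * t).

Definition xexp (f : F) (i : 'I_n) : nat :=
  if i == base (odd i) then
    (\sum_(j < n | odd j == odd i) dexp f j -
     \sum_(j < n | (odd j == odd i) && (j != i)) extend0 f (lshift n j))%N
  else extend0 f (lshift n i).

Definition exponent (f : F) : mon :=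
  xdpart (Multinom [tuple xexp f i | i < n]) (Multinom [tuple dexp f j | j < n]).

Lemma exponent_l f i : exponent f (lshift n i) = xexp f i.
Proof. by rewrite xdpart_l mnmE. Qed.

Lemma exponent_r f i : exponent f (rshift n i) = dexp f i.
Proof. by rewrite xdpart_r mnmE. Qed.

Lemma balanced_exponent f : balanced (exponent f).
Proof.
apply/forallP => c.
under eq_bigr do rewrite exponent_l.
under [X in _ == X]eq_bigr do rewrite exponent_r.
rewrite (bigD1 (base c)) ?odd_base //= {1}/xexp odd_base eqxx.
rewrite [X in (_ + X)%N](eq_bigr (fun j => extend0 f (lshift n j))); last first.
  by move=> j /andP[/eqP jc jb]; rewrite /xexp jc (negPf jb).
rewrite subnK //; rewrite [X in (_ <= X)%N](bigD1 (base c)) ?odd_base //=.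
apply: (@leq_trans (n * t)%N); last first.
  by rewrite -addnA; apply: leq_trans (leq_addl _ _); rewrite odd_base eqxx mul1n leq_addr.
apply: (@leq_trans (\sum_(j < n) t)%N); last by rewrite sum_nat_const card_ord.
rewrite big_mkcond /=; apply: leq_sum => j _.
by case: ifP => // _; exact: extend0_le.
Qed.

Lemma mdeg_exponent f : (mdeg (dpart (exponent f)) <= n * n.+1 * t)%N.
Proof.
rewrite mdegE; apply: (@leq_trans (\sum_(j < n) n.+1 * t)%N); last first.
  by rewrite sum_nat_const card_ord mulnA.
apply: leq_sum => j _; rewrite dpartE exponent_r mulSn /dexp.
apply: leq_add; first exact: extend0_le.
by case: eqP => _; rewrite ?mul1n.
Qed.

Lemma exponent_inj : injective exponent.
Proof.
move=> f f' ff'; apply/ffunP => y; apply/val_inj; rewrite /= -!extend0_val.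
move: (valP y); move: (val y) => x; rewrite -(splitK x).
case: fintype.split => i /= xP.
  have ib : i != base (odd i).
    apply: contraTneq xP => ->; rewrite negb_and !negbK !(inj_eq (@lshift_inj _ _)).
    by case: (odd i); rewrite eqxx ?orbT.
  by have := congr1 (fun m : mon => m (lshift n i)) ff';
     rewrite /= !exponent_l /xexp (negPf ib).
have := congr1 (fun m : mon => m (rshift n i)) ff'.
by rewrite /= !exponent_r /dexp => /addIn.
Qed.

Lemma dim_words_lower M : (n * n.+1 * t <= M)%N ->
  (t.+1 ^ (2 * n - 2) <= Defs.dim_span (words unitops M))%N.
Proof.
move=> tM; set s := words unitops M.
have /choice[idx idxP] (f : F) : exists i : 'I_(size s),
    s`_i != 0 /\ mlead (symb s`_i) = exponent f.
  have [w ws [w0 wf]] := monomial_word (balanced_exponent f)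
    (leq_trans (mdeg_exponent f) tM).
  by rewrite -index_mem in ws; exists (Ordinal ws); rewrite /= nth_index // -index_mem.
have idx_inj : injective idx.
  move=> f f' e; apply: exponent_inj.
  by have [_ <-] := idxP f; have [_ <-] := idxP f'; rewrite e.
have -> : (t.+1 ^ (2 * n - 2))%N = #|[set idx f | f : F]%SET|.
  by rewrite card_imset // card_ffun card_ord card_free_index.
apply: leq_dim_span => c; rewrite big_imset /=; last by move=> ? ? _ _; exact: idx_inj.
move=> c0 _ /imsetP[f0 _ ->]; apply/eqP; apply: contraT => cf0.
have [f cf fmax] := @arg_maxP _ _ _ f0 (fun f => c (idx f) != 0) exponent cf0.
have := congr1 (fun v : A => (symb v)@_(exponent f)) c0.
rewrite symb_sum // mcoeff_sum (bigD1 f) //= big1 => [|f' f'f].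
  rewrite addr0 symbZ // mcoeffZ symb0 // mcoeff0.
  have [s0 sf] := idxP f.
  by move=> /eqP; rewrite mulf_eq0 (negPf cf) -sf mleadc_eq0 symb_eq0 // (negPf s0).
rewrite symbZ // mcoeffZ; have [->|cf'] := eqVneq (c (idx f')) 0; first by rewrite mul0r.
have [_ sf'] := idxP f'.
rewrite mcoeff_gt_mlead ?mulr0 // sf' lt_neqAle (inj_eq exponent_inj) f'f /=.
exact: fmax.
Qed.

End Exponents.

End LowerGrowth.

Section LogarithmicGrowth.

Variable RR : realType.
Local Open Scope classical_set_scope.

Lemma limn_esup_le (u : nat -> \bar RR) (l : RR) :
  (forall e : RR, 0 < e -> exists N, forall m, (N <= m)%N -> (u m <= (l + e)%:E)%E) ->
  (limn_esup u <= l%:E)%E.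
Proof.
move=> h; apply/lee_addgt0Pr => e e0; have [N NP] := h e e0.
apply: (@le_trans _ _ (ereal_sup (u @` [set m | (N <= m)%N]))).
  by apply: ereal_inf_lbound; exists [set m | (N <= m)%N] => //; exists N.
by apply: ge_ereal_sup => _ [m /= Nm <-]; rewrite -EFinD; exact: NP.
Qed.

Lemma limn_esup_ge (u : nat -> \bar RR) (l : RR) :
  (forall e : RR, 0 < e -> exists N, forall m, (N <= m)%N -> ((l - e)%:E <= u m)%E) ->
  (l%:E <= limn_esup u)%E.
Proof.
move=> h; apply/lee_subgt0Pr => e e0; have [N NP] := h e e0.
apply: le_ereal_inf_tmp => _ [V [M _ MV] <-].
apply: (@le_trans _ _ (u (maxn N M))); first by rewrite -EFinB NP ?leq_maxl.
apply: ereal_sup_ubound; exists (maxn N M) => //; apply: MV => /=.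
exact: leq_maxr.
Qed.

Lemma ln_unbounded (B : RR) : exists N, forall m, (N <= m)%N ->
  [/\ (0 < m)%N, 0 < ln (m%:R : RR) & B <= ln (m%:R : RR)].
Proof.
exists (maxn 2 (Num.trunc (expR B)).+1) => m; rewrite geq_max => /andP[m2 mB].
have m0 : 0 < (m%:R : RR) by rewrite ltr0n; lia.
split; [lia|by rewrite ln_gt0 // ltr1n|].
rewrite -[B]expRK ler_ln ?posrE ?expR_gt0 //.
apply: ltW; apply: lt_le_trans (_ : _ < (Num.trunc (expR B)).+1%:R) _.
  by rewrite truncnS_gt.
by rewrite ler_nat.
Qed.

Lemma log_ratio_upper (D : nat -> nat) (d e : nat) :
  (forall m, (D m <= (d * m).+1 ^ e)%N) ->
  (limn_esup (fun m => (ln ((D m)%:R : RR) / ln m%:R)%:E) <= (e%:R : RR)%:E)%E.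
Proof.
move=> Dle; apply: limn_esup_le => eps eps0.
set C : RR := ln d.+1%:R *+ e.
have [N NP] := ln_unbounded (C / eps); exists N => m Nm.
have [m0 lm0 lmC] := NP m Nm; rewrite lee_fin ler_pdivrMr //.
have [D0|D0] := posnP (D m).
  by rewrite D0 ln0 // mulr_ge0 ?addr_ge0 // ltW.
apply: (@le_trans _ _ (C + ln m%:R *+ e)).
  rewrite -mulrnDl -lnM ?posrE ?ltr0n // -lnXn ?mulr_gt0 ?ltr0n //.
  rewrite ler_ln ?posrE ?exprn_gt0 ?mulr_gt0 ?ltr0n //.
  rewrite -natrM -natrX ler_nat; apply: leq_trans (Dle m) _.
  by case: (e) => // e'; rewrite leq_exp2r // mulSn; lia.
rewrite mulrDl addrC lerD //; first by rewrite mulr_natl.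
by rewrite mulrC -ler_pdivrMr.
Qed.

Lemma log_ratio_lower (D : nat -> nat) (K e : nat) : (0 < K)%N ->
  (forall m, ((m %/ K).+1 ^ e <= D m)%N) ->
  ((e%:R : RR)%:E <= limn_esup (fun m => (ln ((D m)%:R : RR) / ln m%:R)%:E))%E.
Proof.
move=> K0 Dge; apply: limn_esup_ge => eps eps0.
set C : RR := ln K%:R *+ e.
have [N NP] := ln_unbounded (C / eps); exists N => m Nm.
have [m0 lm0 lmC] := NP m Nm; rewrite lee_fin ler_pdivlMr //.
apply: (@le_trans _ _ (ln m%:R *+ e - C)).
  rewrite mulrBl mulr_natl lerB //.
  by rewrite mulrC -ler_pdivrMr.
rewrite lerBlDr; apply: (@le_trans _ _ (ln (m %/ K).+1%:R *+ e + C)).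
  rewrite -mulrnDl; apply: ler_wMn2r; rewrite -lnM ?posrE ?ltr0n //.
  rewrite ler_ln ?posrE ?mulr_gt0 ?ltr0n // -natrM ler_nat.
  exact/ltnW/ltn_ceil.
rewrite lerD2r -lnXn ?ltr0n // ler_ln ?posrE ?exprn_gt0 ?ltr0n //.
  by rewrite -natrX ler_nat.
by apply: leq_trans (Dge m); rewrite expn_gt0.
Qed.

End LogarithmicGrowth.

Section GKdimInvariants.

Variables (RR : realType) (k : closedFieldType) (n : nat).
Hypothesis char0 : [pchar k] =i pred0.

Lemma GKdim_invariants : (4 <= n)%N ->
  GKdim RR (weyl_invariants k (alternating_mx n)) = ((2 * n - 2)%N%:R)%:E.
Proof.
move=> n4; apply/eqP; rewrite eq_le; apply/andP; split.
  apply: ge_ereal_sup => _ [s _ <-].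
  have [d dP] := dim_words_upper char0 n4 s.
  exact: log_ratio_upper dP.
apply: (@le_trans _ _ (limn_esup (fun m : nat =>
    (ln ((Defs.dim_span (words (unitops k n) m))%:R : RR) / ln m%:R)%:E))).
  apply: (@log_ratio_lower _ _ (n * n.+1)) => [|m]; first by rewrite muln_gt0; lia.
  by apply: dim_words_lower => //; rewrite mulnC leq_trunc_div.
by apply: ereal_sup_ubound; exists (unitops k n).
Qed.

End GKdimInvariants.

Theorem mainTheorem6 (RR : realType) (k : closedFieldType)
    (k_char0 : [pchar k] =i pred0) :
  (forall n : nat, (4 <= n)%N ->
     [/\ noetherian (weyl_invariants k (alternating_mx n)),
         FCR (weyl_invariants k (alternating_mx n))
       & GKdim RR (weyl_invariants k (alternating_mx n)) = ((2 * n - 2)%N%:R)%:E])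
  /\
  (forall d : nat, ~~ odd d -> (6 <= d)%N ->
     exists A : algType k,
       [/\ noetherian A, FCR A & GKdim RR A = (d%:R)%:E]).
Proof.
have main n : (4 <= n)%N ->
    [/\ noetherian (weyl_invariants k (alternating_mx n)),
        FCR (weyl_invariants k (alternating_mx n))
      & GKdim RR (weyl_invariants k (alternating_mx n)) = ((2 * n - 2)%N%:R)%:E].
  move=> n4; split; first exact: noetherian_invariants.
    exact: FCR_invariants.
  exact: GKdim_invariants.
split=> [//|d d_even d6].
have [|noeth fcr gk] := main d./2.+1; first by lia.
exists (weyl_invariants k (alternating_mx d./2.+1)); split=> //.
by rewrite gk; congr (_%:R)%:E; lia.
Qed.
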